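(* Let $K$ be a local field, $L/K$ an algebraic extension, and $M$ a good $\mathcal O_L$-module. (i) For all sufficiently large $m\in\mathbb N$, $M_{\mathrm{div}}=p^mM\cong(L/\mathcal O_L)^{\oplus r(M)}$; and if $r(M)=n(M)$, then one can take $m=0$. (ii) $M\cong(L/\mathcal O_L)^{\oplus r}$ for some $r\in\mathbb N$ if and only if $r(M)=n(M)$.
   Context: Fix a prime $p$. A local field $K$ is a complete discrete valuation field of characteristic $0$ with residue field $k_K$ of characteristic $p$ such that $[k_K:k_K^p]=p^d<\infty$. $\mathcal O_L$ is the ring of integers of $L$. For an abelian group $M$, $M_{\mathrm{div}}$ is its maximal $p$-divisible subgroup. For a module $M$ over a ring $R$, $\mu(M)$ is the minimal number of generators. An $\mathcal O_L$-module $M$ is *good* if there exist a direct system $\{L_\lambda\}_{\lambda\in\Lambda}$ of finite subextensions of $L/K$ and a direct system $\{M_\lambda\}_{\lambda\in\Lambda}$ of $\mathcal O_{L_\lambda}$-submodules $M_\lambda\subset M$ such that: (a) transition maps are inclusions, i.e. $L_\lambda\subset L_{\lambda'}$ and $M_\lambda\subset M_{\lambda'}$ for $\lambda<\lambda'$, and $L=\bigcup L_\lambda$, $M=\bigcup M_\lambda$; moreover, for $\lambda<\lambda'$ the canonical map $\mathcal O_{L_{\lambda'}}\otimes_{\mathcal O_{L_\lambda}}M_\lambda\to M_{\lambda'}$ is injective; (b) each $M_\lambda$ is an $\mathcal O_{L_\lambda}$-module of finite length and $\sup_\lambda\mu(M_\lambda)<\infty$. Such $\{M_\lambda\}$ is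 called a direct system of $M$. Given one, put $n(M)=\sup_\lambda\mu(M_\lambda)$ and define rationals $e_1^\lambda\ge\dots\ge e_{n(M)}^\lambda\ge0$ by $M_\lambda\cong\bigoplus_{1\le i\le n(M)}\mathcal O_{L_\lambda}/p^{e_i^\lambda}\mathcal O_{L_\lambda}$, where $p^{e}$ denotes any element of $\mathcal O_{L_\lambda}$ of $p$-adic valuation $e$ (normalized by $v_p(p)=1$). Put $r(M)=\#\{i\mid\sup_\lambda e_i^\lambda=\infty\}$. The numbers $n(M)$ and $r(M)$ do not depend on the choice of the direct system. *)

(* Defs.v *)
From HB Require Import structures.
From mathcomp Require Import all_boot all_order all_algebra.
From mathcomp Require Import boolp.

Set Implicit Arguments.
Unset Strict Implicit.
Unset Printing Implicit Defensive.

Import Order.TTheory GRing.Theory Num.Theory.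
Local Open Scope ring_scope.
Local Open Scope quotient_scope.

Definition lmod_isom (R : pzRingType) (U V : lmodType R) : Prop :=
  exists f : {linear U -> V}, bijective f.

Section Submodule.
Variables (R : pzRingType) (V : lmodType R) (N : submodClosed V).

Record submod := Submod { submod_val :> V; _ : submod_val \in N }.

HB.instance Definition _ := [isSub for submod_val].
HB.instance Definition _ := [Choice of submod by <:].
HB.instance Definition _ := [SubChoice_isSubLmodule of submod by <:].

Definition submod_group : {pred V} := N.

Fact submod_group_closed : zmod_closed submod_group.
Proof.
split=> [|x y Nx Ny]; first exact: (rpred0 N).
by rewrite -scaleN1r; apply: (rpredD Nx); apply: (rpredZ (-1) Ny).
Qed.

HB.instance Definition _ :=
  GRing.isZmodClosed.Build V submod_group submod_group_closed.

Definition lquot : Type := {ideal_quot submod_group}.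

HB.instance Definition _ := GRing.Zmodule.on lquot.

Definition lquot_pi (x : V) : lquot := \pi_({ideal_quot submod_group}) x.

Definition lquot_scale (a : R) (x : lquot) : lquot :=
  lquot_pi (a *: repr (x : {ideal_quot submod_group})).

Lemma lquot_piK (x : lquot) : lquot_pi (repr (x : {ideal_quot submod_group})) = x.
Proof. exact: reprK. Qed.

Lemma lquot_piD x y : lquot_pi (x + y) = lquot_pi x + lquot_pi y.
Proof. exact: (raddfD (\pi_({ideal_quot submod_group}))). Qed.

Lemma lquot_scale_pi a x : lquot_scale a (lquot_pi x) = lquot_pi (a *: x).
Proof.
apply/eqP; rewrite /lquot_scale /lquot_pi -Quotient.idealrBE -scalerBr.
by apply: (rpredZ a (_ : _ \in N)); rewrite -/submod_group Quotient.idealrBE reprK.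
Qed.

Fact lquot_scaleA a b x :
  lquot_scale a (lquot_scale b x) = lquot_scale (a * b) x.
Proof. by rewrite -[x]lquot_piK !lquot_scale_pi scalerA. Qed.

Fact lquot_scale1 : left_id 1 lquot_scale.
Proof. by move=> x; rewrite /lquot_scale scale1r lquot_piK. Qed.

Fact lquot_scaleDr : right_distributive lquot_scale +%R.
Proof.
move=> a x y; rewrite -[x]lquot_piK -[y]lquot_piK -lquot_piD !lquot_scale_pi.
by rewrite scalerDr lquot_piD.
Qed.

Fact lquot_scaleDl x : {morph lquot_scale^~ x : a b / a + b}.
Proof. by move=> a b; rewrite /lquot_scale scalerDl lquot_piD. Qed.

HB.instance Definition _ := GRing.Zmodule_isLmodule.Build R lquot
  lquot_scaleA lquot_scale1 lquot_scaleDr lquot_scaleDl.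

End Submodule.

(* V seen as an R-module through f *)
Definition restrict (R S : pzRingType) (f : {rmorphism R -> S})
  (V : lmodType S) : Type := V.

Section Restriction.
Variables (R S : pzRingType) (f : {rmorphism R -> S}) (V : lmodType S).
Local Notation restrict := (restrict f V).

HB.instance Definition _ := GRing.Zmodule.on restrict.

Definition restrict_scale (a : R) (x : restrict) : restrict := f a *: (x : V).

Fact restrict_scaleA a b x :
  restrict_scale a (restrict_scale b x) = restrict_scale (a * b) x.
Proof. by rewrite /restrict_scale scalerA rmorphM. Qed.

Fact restrict_scale1 : left_id 1 restrict_scale.
Proof. by move=> x; rewrite /restrict_scale rmorph1 scale1r. Qed.

Fact restrict_scaleDr : right_distributive restrict_scale +%R.
Proof. by move=> a x y; rewrite /restrict_scale; apply: scalerDr. Qed.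

Fact restrict_scaleDl x : {morph restrict_scale^~ x : a b / a + b}.
Proof. by move=> a b; rewrite /restrict_scale rmorphD; apply: scalerDl. Qed.

HB.instance Definition _ := GRing.Zmodule_isLmodule.Build R restrict
  restrict_scaleA restrict_scale1 restrict_scaleDr restrict_scaleDl.

End Restriction.

Section PrincipalIdeal.
Variables (R : comPzRingType) (x : R).

Definition pideal : {pred R^o} := [pred y | `[< exists a : R, y = a * x >]].

Fact pideal_submod_closed : submod_closed pideal.
Proof.
split=> [|a _ _ /asboolP[b ->] /asboolP[c ->]]; apply/asboolP.
  by exists 0; rewrite mul0r.
by exists (a * b + c); rewrite mulrDl -mulrA.
Qed.

HB.instance Definition _ :=
  GRing.isSubmodClosed.Build R R^o pideal pideal_submod_closed.

End PrincipalIdeal.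

Section Multiples.
Variables (R : pzRingType) (V : lmodType R) (q : nat).

Definition multiples : {pred V} := [pred x | `[< exists y : V, x = y *+ q >]].

Fact multiples_submod_closed : submod_closed multiples.
Proof.
split=> [|a _ _ /asboolP[y ->] /asboolP[z ->]]; apply/asboolP.
  by exists 0; rewrite mul0rn.
by exists (a *: y + z); rewrite mulrnDl scalerMnr.
Qed.

HB.instance Definition _ :=
  GRing.isSubmodClosed.Build R V multiples multiples_submod_closed.

End Multiples.
Arguments multiples {R} V q.

Section FiniteModules.
Variables (R : pzRingType) (V : lmodType R).

Definition generated_by (k : nat) : Prop :=
  exists g : 'I_k -> V,
    forall x : V, exists a : 'I_k -> R, x = \sum_i a i *: g i.

(* mu(V) = k *)
Definition min_gens (k : nat) : Prop :=
  generated_by k /\ forall j, generated_by j -> (k <= j)%N.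

(* Length as the supremum of the lengths of strict chains of submodules. *)
Definition finite_length : Prop :=
  exists b : nat, forall (k : nat) (C : 'I_k.+1 -> submodClosed V),
    (forall i j : 'I_k.+1, (i < j)%N ->
       {subset C i <= C j} /\ exists2 x, x \in C j & x \notin C i) ->
    (k <= b)%N.

End FiniteModules.

(* V is isomorphic to the direct sum of the R / (x i); the maps phi i are the
   components of the isomorphism *)
Definition cyclic_decomposition (R : comPzRingType) (V : lmodType R) (n : nat)
    (x : 'I_n -> R) : Prop :=
  exists phi : forall i, {linear V -> lquot (pideal (x i))},
    forall y : forall i, lquot (pideal (x i)),
      exists! w : V, forall i, phi i w = y i.

Definition pdivisible (G : zmodType) (p : nat) (D : {pred G}) : Prop :=
  zmod_closed D /\ forall x, x \in D -> exists2 y, y \in D & x = y *+ p.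

Definition max_pdivisible (G : zmodType) (p : nat) (D : {pred G}) : Prop :=
  pdivisible p D /\
  forall D' : {pred G}, pdivisible p D' -> {subset D' <= D}.

(* Tensor product A ⊗_R V along f : R -> A: finite formal sums of pairs (a, v),
   modulo the congruence generated by the bilinearity relations.  Opposites are
   given by (- a, v). *)
Section Tensor.
Variables (R A : pzRingType) (f : {rmorphism R -> A}) (V : lmodType R).

Inductive tens_rel : seq (A * V) -> seq (A * V) -> Prop :=
| Tens_refl s : tens_rel s s
| Tens_sym s t : tens_rel s t -> tens_rel t s
| Tens_trans s t u : tens_rel s t -> tens_rel t u -> tens_rel s u
| Tens_cons u s t : tens_rel s t -> tens_rel (u :: s) (u :: t)
| Tens_perm s t : perm_eq s t -> tens_rel s t
| Tens_zero v s : tens_rel ((0, v) :: s) s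
| Tens_addl a b v s : tens_rel ((a + b, v) :: s) [:: (a, v), (b, v) & s]
| Tens_addr a v w s : tens_rel ((a, v + w) :: s) [:: (a, v), (a, w) & s]
| Tens_scale a r v s : tens_rel ((a * f r, v) :: s) ((a, r *: v) :: s).

Definition tens_eqb : rel (seq (A * V)) := fun s t => `[< tens_rel s t >].

Fact tens_eqb_equiv : equiv_class_of tens_eqb.
Proof.
split=> [s|s t|t s u]; first exact/asboolP/Tens_refl.
  by apply/asboolP/asboolP; apply: Tens_sym.
by move=> /asboolP st /asboolP tu; apply/asboolP/(Tens_trans st).
Qed.

Canonical tens_equiv := EquivRelPack tens_eqb_equiv.
Canonical tens_encModRel := defaultEncModRel tens_eqb.

Definition tensor : Type := {eq_quot tens_eqb}.

(* the A-linear map A ⊗_R V -> W, a ⊗ v |-> a g(v), induced by g : V -> W *)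
Definition tensor_lift (W : lmodType A) (g : V -> W) (t : tensor) : W :=
  \sum_(u <- repr (t : {eq_quot tens_eqb})) u.1 *: g u.2.

End Tensor.

(* The value at 0, morally +oo, is irrelevant. *)
Definition valuation_axioms (F : fieldType) (G : realDomainType) (v : F -> G) :
    Prop :=
  (forall x y, x != 0 -> y != 0 -> v (x * y) = v x + v y) /\
  (forall x y, x != 0 -> y != 0 -> x + y != 0 ->
     Num.min (v x) (v y) <= v (x + y)).

Record discreteValuation (K : fieldType) := DiscreteValuation {
  dval :> K -> int;
  dval_axioms : valuation_axioms dval;
  dval_uniformizer : exists2 x, x != 0 & dval x = 1 }.

Section ValuationRing.
Variables (K : fieldType) (v : discreteValuation K).

Definition val_ge (m : int) : {pred K} := [pred x | (x == 0) || (m <= v x)].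

Lemma dvalM x y : x != 0 -> y != 0 -> v (x * y) = v x + v y.
Proof. by case: (dval_axioms v) => H _; apply: H. Qed.

Lemma dval1 : v 1 = 0.
Proof.
have := dvalM (oner_neq0 K) (oner_neq0 K); rewrite mulr1.
by move=> /eqP; rewrite -subr_eq0 opprD addNKr oppr_eq0 => /eqP.
Qed.

Lemma dvalN x : v (- x) = v x.
Proof.
have [->|x0] := eqVneq x 0; first by rewrite oppr0.
have N1 : (-1 : K) != 0 by rewrite oppr_eq0 oner_eq0.
have := dvalM N1 N1; rewrite mulrNN mulr1 dval1 => /esym/eqP.
rewrite -mulr2n mulrn_eq0 /= => /eqP vN1.
by rewrite -mulN1r dvalM // vN1 add0r.
Qed.

Lemma val_geB m : {in val_ge m &, forall x y, x - y \in val_ge m}.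
Proof.
move=> x y; rewrite !inE; have [->|x0] /= := eqVneq x 0.
  by rewrite sub0r oppr_eq0 dvalN.
have [->|y0] /= := eqVneq y 0; first by rewrite subr0 (negPf x0).
move=> mx my; have [//|xy0] /= := eqVneq (x - y) 0.
have [_ /(_ x (- y) x0)] := dval_axioms v; rewrite oppr_eq0 => /(_ y0 xy0).
by apply: le_trans; rewrite dvalN le_min mx.
Qed.

Lemma val_geM m n x y :
  x \in val_ge m -> y \in val_ge n -> x * y \in val_ge (m + n).
Proof.
rewrite !inE mulf_eq0; have [//|x0] /= := eqVneq x 0.
have [//|y0] /= := eqVneq y 0; move=> mx ny.
by rewrite dvalM // lerD.
Qed.

Fact val_ring_subring_closed : subring_closed (val_ge 0).
Proof.
split; first by rewrite inE dval1 lexx orbT.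
  exact: val_geB.
by move=> x y x0 y0; rewrite -[0]addr0 val_geM.
Qed.

HB.instance Definition _ :=
  GRing.isSubringClosed.Build K (val_ge 0) val_ring_subring_closed.

Record val_ring := ValRing { val_ring_val :> K; _ : val_ring_val \in val_ge 0 }.

HB.instance Definition _ := [isSub for val_ring_val].
HB.instance Definition _ := [Choice of val_ring by <:].
HB.instance Definition _ := [SubChoice_isSubComNzRing of val_ring by <:].

Definition max_ideal : {pred val_ring} := [pred x | val x \in val_ge 1].

Fact max_ideal_closed : idealr_closed max_ideal.
Proof.
split; first by rewrite inE /= inE eqxx.
  by rewrite inE /= inE oner_eq0 dval1.
move=> a x y; rewrite !inE => x1 y1 /=.
rewrite -[val y]opprK; apply: val_geB; last by rewrite -sub0r val_geB // inE eqxx.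
by rewrite -[1]add0r; apply: val_geM => //; apply: valP.
Qed.

HB.instance Definition _ := isIdealr.Build val_ring max_ideal max_ideal_closed.

Definition residue_field : comNzRingType := {ideal_quot max_ideal}.

Definition val_complete : Prop :=
  forall u : nat -> K,
    (forall m : int, exists N : nat, forall i j : nat,
       (N <= i)%N -> (N <= j)%N -> u i - u j \in val_ge m) ->
    exists l : K, forall m : int, exists N : nat, forall i : nat,
      (N <= i)%N -> u i - l \in val_ge m.

End ValuationRing.

(* [k : k^p] = m: a family of m elements is a basis of k over k^p *)
Definition frobenius_degree (k : comNzRingType) (p m : nat) : Prop :=
  exists b : 'I_m -> k, forall x : k, exists! c : {ffun 'I_m -> k},
    (forall i, exists y : k, c i = y ^+ p) /\ x = \sum_i c i * b i.

Record local_field (p : nat) (K : fieldType) (v : discreteValuation K) : Prop :=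
  LocalField {
    local_complete : val_complete v;
    local_char0 : [pchar K] =i pred0;
    local_residue_char : p \in [pchar (residue_field v)];
    local_residue_degree : exists d : nat,
      frobenius_degree (residue_field v) p (p ^ d) }.

Section Extension.
Variables (K L : fieldType) (v : discreteValuation K) (iota : {rmorphism K -> L}).

(* integral over O_K *)
Definition integral (x : L) : Prop :=
  integralOver (iota \o (val : val_ring v -> K)) x.

Record subext := Subext {
  subext_pred :> {pred L};
  subext_divring : divring_closed subext_pred;
  subext_base : forall a : K, iota a \in subext_pred }.

Definition finite_subext (F : subext) : Prop :=
  exists (n : nat) (b : 'I_n -> L), (forall i, b i \in F) /\
    forall x, x \in F -> exists a : 'I_n -> K, x = \sum_i iota (a i) * b i.

Fact full_divring : divring_closed (predT : {pred L}). Proof. by []. Qed.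

(* L itself, so that O_L is integers full_subext *)
Definition full_subext : subext :=
  @Subext predT full_divring (fun=> isT).

Definition integers_pred (F : subext) : {pred L} :=
  [pred x | (x \in F) && `[< integral x >]].

Fact integers_subring_closed F : subring_closed (integers_pred F).
Proof.
have [F1 FB FM] := GRing.divring_closedBM (subext_divring F).
split; first by rewrite inE F1; apply/asboolP/integral1.
  move=> x y /andP[Fx /asboolP Ix] /andP[Fy /asboolP Iy].
  by apply/andP; split; [apply: FB | apply/asboolP/integral_sub].
move=> x y /andP[Fx /asboolP Ix] /andP[Fy /asboolP Iy].
by apply/andP; split; [apply: FM | apply/asboolP/integral_mul].
Qed.

HB.instance Definition _ F :=
  GRing.isSubringClosed.Build L (integers_pred F) (integers_subring_closed F).

Record integers (F : subext) :=
  Integers { integers_val :> L; _ : integers_val \in integers_pred F }.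

HB.instance Definition _ F := [isSub for @integers_val F].
HB.instance Definition _ F := [Choice of integers F by <:].
HB.instance Definition _ F := [SubChoice_isSubComNzRing of integers F by <:].

Section Inclusion.
Variables (F F' : subext) (sFF' : {subset F <= F'}).

Fact integers_incl_subproof (x : integers F) : val x \in integers_pred F'.
Proof. by case: x => x /= /andP[Fx Ix]; apply/andP; split=> //; apply: sFF'. Qed.

Definition integers_incl (x : integers F) : integers F' :=
  Integers (integers_incl_subproof x).

Fact integers_incl_zmod : zmod_morphism integers_incl.
Proof. by move=> x y; apply: val_inj. Qed.

Fact integers_incl_monoid : monoid_morphism integers_incl.
Proof. by split=> [|x y]; apply: val_inj. Qed.

HB.instance Definition _ :=
  GRing.isZmodMorphism.Build _ _ integers_incl integers_incl_zmod.
HB.instance Definition _ :=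
  GRing.isMonoidMorphism.Build _ _ integers_incl integers_incl_monoid.

End Inclusion.

Fact sub_full_subext (F : subext) : {subset F <= full_subext}.
Proof. by []. Qed.

Definition ring_of_integers : comNzRingType := integers full_subext.

Definition field_module : lmodType ring_of_integers :=
  restrict (val : integers full_subext -> L) L^o.

Definition integers_in_field : {pred field_module} := integers_pred full_subext.

Fact integers_in_field_closed : submod_closed integers_in_field.
Proof.
split=> [|a x y Ox Oy]; first exact: (rpred0 (integers_pred full_subext)).
apply: (rpredD (_ : _ \in integers_pred full_subext) Oy).
exact: (rpredM (valP a) Ox).
Qed.

HB.instance Definition _ := GRing.isSubmodClosed.Build
  ring_of_integers field_module integers_in_field integers_in_field_closed.

Definition field_mod_integers : lmodType ring_of_integers :=
  lquot integers_in_field.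

Section GoodModule.
Variable M : lmodType ring_of_integers.

Definition module_over (F : subext) : lmodType (integers F) :=
  restrict (integers_incl (@sub_full_subext F)) M.

Definition submod_incl (F F' : subext) (N : submodClosed (module_over F))
    (N' : submodClosed (module_over F'))
    (sNN' : forall x : M, x \in (N : {pred M}) -> x \in (N' : {pred M}))
    (x : submod N) : submod N' :=
  Submod (sNN' (val x) (valP x)).

(* ds_field_cover makes the index
   set non-empty, and the conditions on i < j are trivial for i = j. *)
Record direct_system := DirectSystem {
  ds_disp : Order.disp_t;
  ds_index : porderType ds_disp;
  ds_directed : forall i j : ds_index, exists k, (i <= k)%O /\ (j <= k)%O;
  ds_field : ds_index -> subext;
  ds_module : forall i, submodClosed (module_over (ds_field i));
  ds_field_finite : forall i, finite_subext (ds_field i);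
  ds_field_incl : forall i j, (i < j)%O ->
    {subset ds_field i <= ds_field j};
  ds_module_incl : forall i j, (i < j)%O -> forall x : M,
    x \in (ds_module i : {pred M}) -> x \in (ds_module j : {pred M});
  ds_field_cover : forall x : L, exists i, x \in ds_field i;
  ds_module_cover : forall x : M, exists i, x \in (ds_module i : {pred M});
  ds_tensor_inj : forall i j (ij : (i < j)%O),
    injective (@tensor_lift _ _ (integers_incl (ds_field_incl ij))
      (submod (ds_module i)) (submod (ds_module j))
      (submod_incl (ds_module_incl ij)));
  ds_finite_length : forall i, finite_length (submod (ds_module i));
  ds_bounded : exists b : nat, forall i,
    exists2 k, (k <= b)%N & min_gens (submod (ds_module i)) k }.

Definition good : Prop := inhabited direct_system.

(* n(M) computed on the direct system D *)
Definition ds_sup_gens (D : direct_system) (n : nat) : Prop :=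
  let bound b := forall i k, min_gens (submod (ds_module (d := D) i)) k ->
    (k <= b)%N in
  bound n /\ forall b, bound b -> (n <= b)%N.

(* The extension to L of the valuation of K, normalized by w p = 1; it exists and
   is unique when K is complete and L / K is algebraic. *)
Definition padic_valuation (p : nat) (w : L -> rat) : Prop :=
  valuation_axioms w /\
  forall a : K, a != 0 -> w (iota a) = (v a)%:~R / (v p%:R)%:~R.

Definition ds_exponents (p : nat) (D : direct_system) (n : nat)
    (e : ds_index D -> 'I_n -> rat) : Prop :=
  exists2 w : L -> rat, padic_valuation p w & forall l : ds_index D,
    [/\ forall i j : 'I_n, (i <= j)%N -> e l j <= e l i,
        forall i, 0 <= e l i
      & exists x : 'I_n -> integers (ds_field l),
          (forall i, x i != 0 /\ w (val (x i)) = e l i) /\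
          cyclic_decomposition (submod (ds_module l)) x].

(* n = n(M) and r = r(M), both computed on one direct system of M *)
Definition good_invariants (p n r : nat) : Prop :=
  exists (D : direct_system) (e : ds_index D -> 'I_n -> rat),
    [/\ ds_sup_gens D n, ds_exponents p e
      & r = #|[set i : 'I_n | `[< forall b : rat, exists l, b < e l i >]]|].

End GoodModule.

End Extension.

(* Main.v *)
From HB Require Import structures.
Require Import Defs.
From mathcomp Require Import all_boot all_order all_algebra.
From mathcomp Require Import boolp.
From mathcomp Require Import ring.

Set Implicit Arguments.
Unset Strict Implicit.
Unset Printing Implicit Defensive.
Local Open Scope ring_scope.

Import Order.TTheory GRing.Theory Num.Theory.

(** The module is a directed union of stages, the spans over O_L of the M_lambda. The
    extension w of the valuation makes O_L a valuation ring ([integers_valuation_ring]: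
    an element with w >= 0 is integral over O_K, by completeness of K), and
    injectivity of the maps from O_lambda' (x) M_lambda to M_lambda' makes the stage of index lambda a direct sum
    of cyclic modules O_L / p^(e_i^lambda) ([ds_exhaustion]). From then on the argument
    is linear algebra over the valuation ring A = O_L, and its only tool is that m
    elements in the span of k < m elements satisfy a relation with a coefficient
    equal to 1 ([relation_in_span]).

    With this tool, e_i^lambda is seen to grow with lambda
    ([exhaustion_exponents_mono]); hence the first r exponents become simultaneously
    arbitrarily large, while the other ones are bounded by some m. For such an m,
    T = p^m M is locally generated by the r elements p^m g_i with i < r. An element
    of T killed by p^k, written on generators with much larger exponents, has
    coefficients divisible by p; so T is p-divisible ([multiples_divisible]), and being
    of the form p^m M it contains every p-divisible subgroup. Its p-torsion is free over
    A/p on the elements (p^(e_i) / p) g_i of any late enough stage. Dividing this basis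
    by p repeatedly gives compatible bases of the p^k-torsion, whence
    T = (L/A)^r ([divisible_cofree]). If r = n, every m is allowed, including 0.

    Conversely, if M is a power of L/A, then M is p-divisible. At a stage where the
    number of generators is exactly n, all exponents are positive
    ([positive_exponents]), so the n generators satisfy no primitive relation. A bound m
    on the exponents of some index i would put them, as multiples of p^m, in the span of
    i < n elements; so all the exponents are unbounded ([divisible_unbounded]) and
    r = n. *)

(** * Valuations and valuation rings *)

Section Valuation.
Variables (F : fieldType) (G : realDomainType) (w : F -> G).
Hypothesis wP : valuation_axioms w.

Lemma valuationM x y : x != 0 -> y != 0 -> w (x * y) = w x + w y.
Proof. by case: wP => H _; apply: H. Qed.

Lemma valuation1 : w 1 = 0.
Proof.
have /eqP := valuationM (oner_neq0 F) (oner_neq0 F).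
by rewrite mulr1 -subr_eq0 opprD addNKr oppr_eq0 => /eqP.
Qed.

Lemma valuationV x : x != 0 -> w x^-1 = - w x.
Proof.
move=> x0; apply/eqP; rewrite -addr_eq0 -valuationM ?invr_eq0 //.
by rewrite mulVf // valuation1.
Qed.

Lemma valuationX x k : x != 0 -> w (x ^+ k) = w x *+ k.
Proof.
move=> x0; elim: k => [|k IH]; first by rewrite expr0 valuation1.
by rewrite exprS valuationM ?expf_neq0 // IH mulrS.
Qed.

(** The closed ball, with [0] in it whatever the junk value [w 0] is. *)
Definition vge (c : G) : {pred F} := [pred x | (x == 0) || (c <= w x)].

Lemma vgeD c : {in vge c &, forall x y, x + y \in vge c}.
Proof.
move=> x y; rewrite !inE; have [->|x0] /= := eqVneq x 0; first by rewrite add0r.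
have [->|y0] /= := eqVneq y 0; first by rewrite addr0 (negPf x0).
move=> cx cy; have [//|xy0] /= := eqVneq (x + y) 0.
by case: wP => _ /(_ x y x0 y0 xy0); apply: le_trans; rewrite le_min cx.
Qed.

Lemma vgeM c d x y : x \in vge c -> y \in vge d -> x * y \in vge (c + d).
Proof.
rewrite !inE mulf_eq0; have [//|x0] /= := eqVneq x 0.
by have [//|y0] /= := eqVneq y 0; move=> cx dy; rewrite valuationM // lerD.
Qed.

Lemma vge_sum (I : Type) (s : seq I) (P : pred I) (f : I -> F) c :
  (forall i, P i -> f i \in vge c) -> \sum_(i <- s | P i) f i \in vge c.
Proof. by move=> H; elim/big_ind: _ => //; [rewrite inE eqxx | exact: vgeD]. Qed.

End Valuation.

(** The ring of [w] is given by an abstract ring [A] embedded in its field, so that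
    modules over a ring of integers can be used without unfolding the latter. *)
Definition valuation_ring (A : comNzRingType) (L : fieldType)
    (j : {rmorphism A -> L}) (w : L -> rat) : Prop :=
  [/\ valuation_axioms w, injective j
    & forall x, x \in vge w 0 <-> exists a, j a = x].

Definition divides (A : comNzRingType) (a b : A) : Prop := exists c, b = c * a.

(** * Relations between elements of a module *)

(** The [g i] span a direct sum of cyclic modules [A / x i], without any mention of
    quotients. *)
Definition diagonal_relations (A : comNzRingType) (V : lmodType A) (k : nat)
    (g : 'I_k -> V) (x : 'I_k -> A) : Prop :=
  forall a : 'I_k -> A, \sum_i a i *: g i = 0 <-> forall i, divides (x i) (a i).

Definition in_span (A : comNzRingType) (V : lmodType A) (k : nat)
    (g : 'I_k -> V) (x : V) : Prop :=
  exists a : 'I_k -> A, x = \sum_i a i *: g i.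

Section Spans.
Variables (A : comNzRingType) (V : lmodType A).

Lemma in_spanZ k (g : 'I_k -> V) a x : in_span g x -> in_span g (a *: x).
Proof.
move=> [c ->]; exists (fun i => a * c i); rewrite scaler_sumr.
by apply: eq_bigr => i _; rewrite scalerA.
Qed.

Lemma in_spanD k (g : 'I_k -> V) x y :
  in_span g x -> in_span g y -> in_span g (x + y).
Proof.
move=> [c ->] [d ->]; exists (fun i => c i + d i); rewrite -big_split.
by apply: eq_bigr => i _; rewrite scalerDl.
Qed.

Lemma in_span_trans k k' (g : 'I_k -> V) (g' : 'I_k' -> V) x :
  (forall i, in_span g' (g i)) -> in_span g x -> in_span g' x.
Proof.
move=> gg' [c ->]; elim/big_ind: _ => [||i _]; last exact: in_spanZ.
  by exists (fun=> 0); rewrite big1 // => i _; rewrite scale0r.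
exact: in_spanD.
Qed.

(** The generators killed by [z] may be dropped from a generating family of the
    multiples by [z]: this is how a bound on the exponents lowers the number of
    generators. *)
Lemma in_span_scale k n (le_kn : (k <= n)%N) (g : 'I_n -> V) z x :
  (forall i : 'I_n, (k <= i)%N -> z *: g i = 0) -> in_span g x ->
  in_span (fun i : 'I_k => z *: g (widen_ord le_kn i)) (z *: x).
Proof.
move=> zg0 [c ->]; exists (fun i => c (widen_ord le_kn i)); rewrite scaler_sumr.
rewrite (bigID (fun i : 'I_n => (i < k)%N)) /= big_ord_narrow.
rewrite [X in _ + X]big1 ?addr0 => [|i]; last first.
  by rewrite -leqNgt => /zg0 E; rewrite scalerA mulrC -scalerA E scaler0.
by apply: eq_bigr => i _; rewrite !scalerA mulrC.
Qed.

Lemma sum_delta n (g : 'I_n -> V) i : \sum_i' (i' == i)%:R *: g i' = g i.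
Proof.
rewrite (bigD1 i) //= eqxx scale1r big1 ?addr0 // => i' /negPf->.
by rewrite scale0r.
Qed.

Lemma diagonal_relations_ann n (g : 'I_n -> V) (x : 'I_n -> A) i z :
  diagonal_relations g x -> divides (x i) z -> z *: g i = 0.
Proof.
move=> gx xz; rewrite -(sum_delta g i) scaler_sumr.
under eq_bigr => i' _ do rewrite scalerA.
apply/gx => i'; have [->|_] := eqVneq i' i; first by rewrite mulr1.
by exists 0; rewrite mulr0 mul0r.
Qed.

End Spans.

Section ValuationRing.
Variables (A : comNzRingType) (L : fieldType) (j : {rmorphism A -> L}).
Variable w : L -> rat.
Hypothesis AP : valuation_ring j w.

Let wP : valuation_axioms w. Proof. by case: AP. Qed.

Lemma vring_eq0 (a : A) : (j a == 0) = (a == 0).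
Proof. by case: AP => _ ji _; rewrite -(inj_eq ji) rmorph0. Qed.

Lemma vring_ge0 (a : A) : a != 0 -> 0 <= w (j a).
Proof.
move=> a0; case: AP => _ _ /(_ (j a)) [_ /(_ (ex_intro _ a erefl))].
by rewrite inE vring_eq0 (negPf a0).
Qed.

Lemma vringMI (c a b : A) : c != 0 -> c * a = c * b -> a = b.
Proof.
rewrite -vring_eq0 => c0 E; case: AP => _ ji _; apply: ji.
by apply: (mulfI c0); rewrite -!rmorphM E.
Qed.

Lemma dividesP (a b : A) : a != 0 -> b != 0 -> divides a b <-> w (j a) <= w (j b).
Proof.
move=> a0 b0; have ja : j a != 0 by rewrite vring_eq0.
have jb : j b != 0 by rewrite vring_eq0.
split=> [[c Eb]|le_ab].
  have c0 : c != 0 by apply: contraNneq b0 => c0; rewrite Eb c0 mul0r.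
  by rewrite Eb rmorphM valuationM ?vring_eq0 // lerDr vring_ge0.
case: AP => _ ji /(_ (j b / j a)) [+ _]; case=> [|c Ec].
  by rewrite inE valuationM ?invr_eq0 // valuationV // subr_ge0 le_ab orbT.
by exists c; apply: ji; rewrite rmorphM Ec divfK.
Qed.

Lemma divides_total (a b : A) : divides a b \/ divides b a.
Proof.
have [->|a0] := eqVneq a 0; first by right; exists 0; rewrite mul0r.
have [->|b0] := eqVneq b 0; first by left; exists 0; rewrite mul0r.
by case: (lerP (w (j a)) (w (j b))) => [|/ltW] H; [left|right]; exact/dividesP.
Qed.

(** Over the field there is a nontrivial relation between the rows, because there
    are more rows than columns; dividing it by a coefficient of least valuation
    makes it integral and primitive. *)
Lemma primitive_relation (m k : nat) (C : 'I_m -> 'I_k -> A) : (k < m)%N ->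
  exists2 u : 'I_m -> A, forall c, \sum_i u i * C i c = 0 & exists i, u i = 1.
Proof.
move=> lt_km; pose B : 'M[L]_(m, k) := \matrix_(i, c) j (C i c).
have : kermx B != 0.
  by rewrite -mxrank_eq0 mxrank_ker subn_eq0 -ltnNge (leq_ltn_trans (rank_leq_col B)).
case/rowV0Pn=> u /sub_kermxP uB u0.
have [i0 ui0] : exists i, u 0 i != 0.
  apply/existsP; apply: contraNT u0 => /existsPn H.
  by apply/eqP/rowP => i; rewrite mxE; apply/eqP/negbNE/H.
case: (@arg_minP _ _ _ i0 (fun i => u 0 i != 0) (fun i => w (u 0 i)) ui0) => l ul lmin.
have H i : exists a, j a = u 0 i / u 0 l.
  case: AP => _ _ HA; apply/HA; rewrite inE mulf_eq0 invr_eq0.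
  have [//|ui /=] := eqVneq (u 0 i) 0.
  by rewrite valuationM ?invr_eq0 // valuationV // subr_ge0 lmin ?orbT.
have [a Ea] := choice H; case: AP => _ ji _; exists a => [c|].
  apply: ji; rewrite rmorph0 rmorph_sum /=.
  have /rowP/(_ c) := uB; rewrite !mxE => /(congr1 (fun x => x / u 0 l)).
  rewrite mul0r mulr_suml => {2}<-; apply: eq_bigr => i _.
  by rewrite rmorphM Ea mxE mulrAC.
by exists l; apply: ji; rewrite Ea divff // rmorph1.
Qed.

(** The substitute for invariant factors: all comparisons of numbers of generators,
    of exponents and of torsion submodules below come from this relation. *)
Lemma relation_in_span (V : lmodType A) (m k : nat) (h : 'I_m -> V)
    (g : 'I_k -> V) : (k < m)%N -> (forall i, in_span g (h i)) ->
  exists2 u : 'I_m -> A, \sum_i u i *: h i = 0 & exists i, u i = 1.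
Proof.
move=> lt_km /choice [C EC]; have [u uC u1] := primitive_relation C lt_km.
exists u => //; under eq_bigr => i _ do rewrite EC scaler_sumr.
rewrite exchange_big big1 // => c _.
under eq_bigr => i _ do rewrite scalerA.
by rewrite -scaler_suml uC scale0r.
Qed.

End ValuationRing.

(** * Modules isomorphic to a power of L/A *)

(** A linear correspondence that is total and injective both ways is the graph of an
    isomorphism; this spares a proof that a formula on representatives is well
    defined. *)
Lemma lmod_isom_of_relation (A : comNzRingType) (U V : lmodType A)
    (R : U -> V -> Prop) :
  (forall u, exists v, R u v) -> (forall v, exists u, R u v) ->
  (forall a u u' v v', R u v -> R u' v' -> R (a *: u + u') (a *: v + v')) ->
  (forall v, R 0 v -> v = 0) -> (forall u, R u 0 -> u = 0) ->
  lmod_isom U V.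
Proof.
move=> /choice [f fP] /choice [g gP] Rlin R0l R0r.
have RB u u' v v' : R u v -> R u' v' -> R (u - u') (v - v').
  by move=> H H'; rewrite ![_ - _]addrC -!scaleN1r; apply: Rlin.
have Rfun u v v' : R u v -> R u v' -> v = v'.
  move=> H /(RB _ _ _ _ H); rewrite subrr => /R0l /eqP.
  by rewrite subr_eq0 => /eqP.
have Rinj u u' v : R u v -> R u' v -> u = u'.
  move=> H /(RB _ _ _ _ H); rewrite subrr => /R0r /eqP.
  by rewrite subr_eq0 => /eqP.
have flin : linear f by move=> a u v; apply: (Rfun _ _ _ (fP _)); apply: Rlin.
pose F : {linear U -> V} := HB.pack f (GRing.isLinear.Build A U V _ f flin).
exists F; exists g => [u|v]; first exact: Rinj (gP _) (fP _).
exact: Rfun (fP _) (gP _).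
Qed.

Lemma uniform_bound (I : finType) (P : I -> nat -> Prop) :
  (forall i, exists k, forall m, (k <= m)%N -> P i m) ->
  exists k, forall i m, (k <= m)%N -> P i m.
Proof.
move=> /choice [f fP]; exists (\max_i f i)%N => i m le_fm.
by apply: fP; apply: leq_trans le_fm; apply: leq_bigmax.
Qed.

(** [Q], with projection [pi], is the quotient of [L] by [A]. *)
Record field_mod_ring (A : comNzRingType) (L : fieldType)
    (j : {rmorphism A -> L}) (Q : lmodType A) (pi : L -> Q) : Prop :=
  FieldModRing {
    fmr_add : {morph pi : x y / x + y};
    fmr_scale : forall a x, pi (j a * x) = a *: pi x;
    fmr_surj : forall y, exists x, pi x = y;
    fmr_ker : forall x, pi x = 0 <-> exists a, j a = x }.

Section Divisible.
Variables (A : comNzRingType) (L : fieldType) (j : {rmorphism A -> L}).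
Variables (w : L -> rat) (p : nat).
Hypothesis AP : valuation_ring j w.
Hypothesis p_neq0 : p%:R != 0 :> L.
Hypothesis wp : 0 < w p%:R.

Let wP : valuation_axioms w. Proof. by case: AP. Qed.
Let P : A := p%:R.
Let jP : j P = p%:R. Proof. exact: rmorph_nat. Qed.

Let P_neq0 k : P ^+ k != 0.
Proof. by rewrite -(vring_eq0 AP) rmorphXn /= jP expf_neq0. Qed.

Lemma p_power_val_ge (c : rat) :
  exists k, forall m, (k <= m)%N -> c <= w (p%:R ^+ m).
Proof.
exists (Num.bound `|c / w p%:R|) => m le_km.
rewrite (valuationX wP) // -[_ *+ m]mulr_natl -ler_pdivrMr //.
apply: le_trans (ler_norm _) _; apply: le_trans (ltW (archi_boundP (normr_ge0 _))) _.
by rewrite ler_nat.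
Qed.

Lemma p_power_denominator (x : L) :
  exists k, forall m, (k <= m)%N -> exists a, j a = x * p%:R ^+ m.
Proof.
have [->|x0] := eqVneq x 0.
  by exists 0%N => m _; exists 0; rewrite rmorph0 mul0r.
have [k Hk] := p_power_val_ge (- w x); exists k => m /Hk le_xm.
case: AP => _ _ /(_ (x * p%:R ^+ m)) [+ _]; apply.
by rewrite inE (valuationM wP) ?expf_neq0 // -lerBlDl sub0r le_xm orbT.
Qed.

Section CompatibleBases.
Variables (T : lmodType A) (r : nat).
Hypothesis Tdiv : forall t : T, exists t', t = t' *+ p.
Hypothesis Tspan : forall h : 'I_r.+1 -> T, exists g : 'I_r -> T,
  forall i, in_span g (h i).
Variable b : 'I_r -> T.
Hypothesis bP : diagonal_relations b (fun=> P).

(** An injective endomorphism of the free module [(A/p)^r] is surjective, in a form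
    that needs no determinant. The [r + 1] elements [t], [b i] lie in the span of [r]
    elements, so they have a primitive relation. If the coefficient [u] of [t] divides [p], multiplying the relation by
    [p / u] kills [t], and the independence of the [b i] makes [u] divide all the
    coefficients: it is a unit, and [t] can be solved for. Otherwise [p] divides [u]
    and all the other coefficients, so [p] is a unit and [t = 0]. *)
Lemma torsion_span t : P *: t = 0 -> in_span b t.
Proof.
move=> Pt0; pose h (i : 'I_r.+1) := if unlift ord0 i is Some i' then b i' else t.
have [g gP] := Tspan h.
have [u] := relation_in_span AP (ltnSn r) gP.
rewrite big_ord_recl {1}/h unlift_none.
under eq_bigr => i _ do rewrite /h liftK.
set s := (X in _ + X) => u0 [i0 ui0].
have Eus : u ord0 *: t = - s by apply/eqP; rewrite -addr_eq0 u0.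
have [[c Ec]|[c Ec]] := divides_total AP (u ord0) P; last first.
  have /bP dvd : s = 0.
    by apply: oppr_inj; rewrite -Eus Ec -scalerA Pt0 scaler0 oppr0.
  suff [d d1] : divides P 1.
    exists (fun=> 0); rewrite big1 => [|i _]; last by rewrite scale0r.
    by rewrite -[t]scale1r d1 -scalerA Pt0 scaler0.
  case: (unliftP ord0 i0) ui0 => [i'|] -> <-; first exact: dvd.
  by exists c.
have c0 : c != 0.
  by apply: contraNneq (P_neq0 1) => c0; rewrite expr1 Ec c0 mul0r.
have /bP dvd : \sum_i (c * u (lift ord0 i)) *: b i = 0.
  under eq_bigr => i _ do rewrite -scalerA.
  by rewrite -scaler_sumr -[X in c *: X]opprK -Eus scalerN scalerA -Ec Pt0 oppr0.
suff [d d1] : divides (u ord0) 1.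
  exists (fun i => - (d * u (lift ord0 i))); rewrite -[t]scale1r d1 -scalerA Eus.
  rewrite scalerN scaler_sumr -sumrN; apply: eq_bigr => i _.
  by rewrite scaleNr scalerA.
case: (unliftP ord0 i0) ui0 => [i'|] -> <-; last by exists 1; rewrite mul1r.
have [d Ed] := dvd i'; exists d.
by apply: (vringMI AP c0); rewrite Ed Ec mulrCA.
Qed.

(** Dividing the basis [b] of the [p]-torsion by [p] again and again gives a basis
    [B k] of the [p ^ k.+1]-torsion for each [k], by induction on [k]. These bases are
    compatible with multiplication by [p]. *)
Lemma divided_bases : exists B : nat -> 'I_r -> T,
  [/\ forall m k i, P ^+ m *: B (m + k)%N i = B k i,
      forall k, diagonal_relations (B k) (fun=> P ^+ k.+1)
    & forall k t, P ^+ k.+1 *: t = 0 -> in_span (B k) t].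
Proof.
have [dv dvP] := choice Tdiv; pose B k i := iter k dv (b i); exists B.
have BS k i : P *: B k.+1 i = B k i by rewrite /B /= scaler_nat -dvP.
have Bm m k i : P ^+ m *: B (m + k)%N i = B k i.
  elim: m => [|m IH]; first by rewrite expr0 scale1r.
  by rewrite exprSr -scalerA addSn BS.
have B0 k i : P ^+ k *: B k i = b i by have := Bm k 0 i; rewrite addn0.
have Bann k i : P ^+ k.+1 *: B k i = 0.
  rewrite exprS -scalerA B0; apply: (diagonal_relations_ann bP).
  by exists 1; rewrite mul1r.
have indep k : diagonal_relations (B k) (fun=> P ^+ k.+1).
  move=> a; split; last first.
    move=> /choice [c Ec]; apply: big1 => i _.
    by rewrite Ec -scalerA Bann scaler0.
  elim: k a => [|k IH] a; first by move=> /bP.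
  move=> a0; have /IH/choice [c Ec] : \sum_i a i *: B k i = 0.
    rewrite -[RHS](scaler0 _ P) -[in RHS]a0 scaler_sumr; apply: eq_bigr => i _.
    by rewrite scalerA mulrC -scalerA BS.
  have /bP dvd : \sum_i c i *: b i = 0.
    rewrite -[RHS]a0; apply: eq_bigr => i _; by rewrite Ec -scalerA B0.
  by move=> i; have [d Ed] := dvd i; exists d; rewrite exprS mulrA -Ed.
split=> // k; elim: k => [|k IH] t; first exact: torsion_span.
rewrite exprS -scalerA => /torsion_span [a Ea].
have [|c Ec] := IH (t - \sum_i a i *: B k.+1 i).
  rewrite scalerBr Ea scaler_sumr; apply/eqP; rewrite subr_eq0; apply/eqP.
  by apply: eq_bigr => i _; rewrite scalerA mulrC -scalerA B0.
exists (fun i => c i * P + a i); rewrite -[t](subrK (\sum_i a i *: B k.+1 i)) Ec.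
by rewrite -big_split; apply: eq_bigr => i _; rewrite scalerDl -scalerA BS.
Qed.

End CompatibleBases.

(** The correspondence sends [\sum_i a i *: B k i] to the vector of the classes of
    [a i / p ^ k.+1]. It is independent of the level [k] because the bases are
    compatible, and both kernels vanish because the relations of [B k] are exactly
    the multiples of [p ^ k.+1]. *)
Theorem divisible_cofree (T : lmodType A) (r : nat) (b : 'I_r -> T)
    (Q : lmodType A) (pi : L -> Q) :
  field_mod_ring j pi ->
  (forall t : T, exists t', t = t' *+ p) ->
  (forall t : T, exists k, t *+ p ^ k = 0) ->
  (forall h : 'I_r.+1 -> T, exists g : 'I_r -> T, forall i, in_span g (h i)) ->
  diagonal_relations b (fun=> P) ->
  lmod_isom T {ffun 'I_r -> Q}.
Proof.
move=> [piD piZ pi_surj pi_ker] Tdiv Ttors Tspan bP.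
have [B [Bm indep gen]] := divided_bases Tdiv Tspan bP.
have jP0 k : j (P ^+ k) != 0 by rewrite (vring_eq0 AP).
pose fr k a := pi (j a / j (P ^+ k.+1)).
have fr0 k a : fr k a = 0 <-> divides (P ^+ k.+1) a.
  rewrite /fr pi_ker; split=> -[c Ec]; exists c.
    by case: AP => _ ji _; apply: ji; rewrite rmorphM Ec divfK.
  by rewrite Ec rmorphM mulfK.
pose R (t : T) (y : {ffun 'I_r -> Q}) :=
  exists k (a : 'I_r -> A), t = \sum_i a i *: B k i /\ forall i, y i = fr k (a i).
have up m k (a : 'I_r -> A) :
    \sum_i a i *: B k i = \sum_i (a i * P ^+ m) *: B (m + k)%N i.
  by apply: eq_bigr => i _; rewrite -scalerA Bm.
have frup m k a : fr k a = fr (m + k)%N (a * P ^+ m).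
  rewrite /fr -addnS exprD (rmorphM j a) (rmorphM j (P ^+ m)).
  by rewrite (mulrC (j a) (j (P ^+ m))) -mulf_div divff // mul1r.
apply: (lmod_isom_of_relation (R := R)).
- move=> t; have [k tk] := Ttors t.
  have /gen [a Ea] : P ^+ k.+1 *: t = 0.
    by rewrite exprS -scalerA -natrX scaler_nat tk scaler0.
  by exists [ffun i => fr k (a i)], k, a; split=> // i; rewrite ffunE.
- move=> y; have [z Ez] := choice (fun i => pi_surj (y i)).
  have [k Hk] := uniform_bound (fun i => p_power_denominator (z i)).
  have [a Ea] := choice (fun i => Hk i k.+1 (leqnSn k)).
  exists (\sum_i a i *: B k i), k, a; split=> // i.
  by rewrite /fr Ea rmorphXn /= jP mulfK ?Ez // expf_neq0.
- move=> c t t' y y' [k [a [-> Ey]]] [k' [a' [-> Ey']]].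
  exists (k' + k)%N, (fun i => c * (a i * P ^+ k') + a' i * P ^+ k).
  split=> [|i].
    rewrite (up k' k) (up k k') addnC scaler_sumr -big_split; apply: eq_bigr => i _.
    by rewrite scalerDl scalerA.
  rewrite !ffunE Ey Ey' (frup k' k) (frup k k') addnC /fr.
  by rewrite -piZ -piD (rmorphD j) (rmorphM j c) mulrDl mulrA.
- move=> y [k [a [/esym/indep dvd Ey]]]; apply/ffunP => i; rewrite Ey ffunE.
  exact/fr0.
- move=> t [k [a [-> Ey]]]; apply/indep => i; apply/fr0.
  by rewrite -Ey ffunE.
Qed.

End Divisible.

(** * Modules exhausted by sums of cyclic modules *)

Section Systems.
Variables (A : comNzRingType) (L : fieldType) (j : {rmorphism A -> L}).
Variables (w : L -> rat) (p : nat).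
Hypothesis AP : valuation_ring j w.
Hypothesis p_neq0 : p%:R != 0 :> L.
Hypothesis wp : w p%:R = 1.

Let wP : valuation_axioms w. Proof. by case: AP. Qed.
Let P : A := p%:R.
Let jP : j P = p%:R. Proof. exact: rmorph_nat. Qed.
Let P_neq0 k : P ^+ k != 0.
Proof. by rewrite -(vring_eq0 AP) rmorphXn /= jP expf_neq0. Qed.
Let wPX k : w (j (P ^+ k)) = k%:R.
Proof. by rewrite rmorphXn /= jP (valuationX wP) // wp. Qed.
Let wp_gt0 : 0 < w p%:R. Proof. by rewrite wp. Qed.

(** [M] as a directed union of submodules that are direct sums of [n] cyclic modules
    [A / x l i], with exponents [w (j (x l i))] decreasing in [i]. Generators replace
    the submodules, and the order of the index type is replaced by inclusion of
    spans. *)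
Record exhaustion (M : lmodType A) (n : nat) (I : Type) (g : I -> 'I_n -> M)
    (x : I -> 'I_n -> A) : Prop := Exhaustion {
  exh_neq0 : forall l i, x l i != 0;
  exh_anti : forall l (i i' : 'I_n), (i <= i')%N ->
    w (j (x l i')) <= w (j (x l i));
  exh_rel : forall l, diagonal_relations (g l) (x l);
  exh_cover : forall y, exists l, in_span (g l) y;
  exh_directed : forall l l', exists l'',
    (forall i, in_span (g l'') (g l i)) /\ (forall i, in_span (g l'') (g l' i)) }.

Variables (M : lmodType A) (n : nat) (I : Type) (g : I -> 'I_n -> M).
Variable x : I -> 'I_n -> A.
Hypothesis gx : exhaustion g x.

Let e l i := w (j (x l i)).

Lemma exhaustion_ann l i z : divides (x l i) z -> z *: g l i = 0.
Proof. by move=> xz; apply: (diagonal_relations_ann (exh_rel gx l)). Qed.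

Lemma exhaustion_rel_prefix k (le_kn : (k <= n)%N) l (a y : 'I_k -> A) :
  \sum_i a i *: (y i *: g l (widen_ord le_kn i)) = 0 <->
  forall i, divides (x l (widen_ord le_kn i)) (a i * y i).
Proof.
pose c (i : 'I_n) := if insub (val i) is Some i' then a i' * y i' else 0.
have cE i : c (widen_ord le_kn i) = a i * y i.
  by rewrite /c /= valK.
have c0 (i : 'I_n) : ~~ (i < k)%N -> c i = 0.
  by move=> ik; rewrite /c insubN.
have -> : \sum_i a i *: (y i *: g l (widen_ord le_kn i)) = \sum_i c i *: g l i.
  rewrite [RHS](bigID (fun i : 'I_n => (i < k)%N)) /= big_ord_narrow.
  rewrite [X in _ = _ + X]big1 ?addr0 => [|i /c0->]; last by rewrite scale0r.
  by apply: eq_bigr => i _; rewrite cE scalerA.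
rewrite (exh_rel gx); split=> H i; first by rewrite -cE.
have [ik|ik] := boolP (i < k)%N.
  by have := H (Ordinal ik); rewrite -cE; congr (divides (x l _) (c _)); apply: val_inj.
by rewrite c0 //; exists 0; rewrite mul0r.
Qed.

(** If the [i]-th exponent went down from [l] to [l'], then multiplying by [y := x l' i]
    would kill all but [i] of the generators at [l'], whereas the multiples by [y] of
    the first [i.+1] generators at [l] have no primitive relation. *)
Lemma exhaustion_exponents_mono l l' i :
  (forall i, in_span (g l') (g l i)) -> e l i <= e l' i.
Proof.
move=> ll'; rewrite leNgt; apply/negP => lt_e.
set y := x l' i.
have y_kills (i' : 'I_n) : (i <= i')%N -> y *: g l' i' = 0.
  move=> ii'; apply: exhaustion_ann.
  by apply/(dividesP AP (exh_neq0 gx l' i') (exh_neq0 gx l' i))/(exh_anti gx).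
have [u] := @relation_in_span _ _ _ _ AP M i.+1 i
  (fun c => y *: g l (widen_ord (ltn_ord i) c))
  (fun c => y *: g l' (widen_ord (ltnW (ltn_ord i)) c)) (ltnSn i)
  (fun c => in_span_scale (ltnW (ltn_ord i)) y_kills (ll' _)).
move=> /(exhaustion_rel_prefix (ltn_ord i) l u (fun=> y)) dvd [c uc].
have := dvd c; rewrite uc mul1r => /(dividesP AP (exh_neq0 gx _ _) (exh_neq0 gx _ _)).
apply/negP; rewrite -ltNge; apply: lt_le_trans lt_e _.
by apply: (exh_anti gx); rewrite /= -ltnS.
Qed.

Lemma exhaustion_absorbs l s (h : 'I_s -> M) : exists l',
  (forall i, in_span (g l') (g l i)) /\ (forall i, in_span (g l') (h i)).
Proof.
elim: s h => [|s IH] h.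
  have [l' [ll' _]] := exh_directed gx l l; exists l'; split=> // -[] //.
have [l1 [ll1 hl1]] := IH (fun i => h (lift ord0 i)).
have [l2 hl2] := exh_cover gx (h ord0).
have [l' [l1l' l2l']] := exh_directed gx l1 l2; exists l'; split=> i.
  exact: in_span_trans l1l' _.
case: (unliftP ord0 i) => [i'|] ->; first exact: in_span_trans l1l' _.
exact: in_span_trans l2l' _.
Qed.

Lemma exhaustion_torsion (y : M) : exists k, P ^+ k *: y = 0.
Proof.
have [l [a ->]] := exh_cover gx y.
have [k Hk] := uniform_bound (fun i => p_power_val_ge AP p_neq0 wp_gt0 (e l i)).
exists k; rewrite scaler_sumr big1 // => i _; rewrite scalerA mulrC -scalerA.
rewrite exhaustion_ann ?scaler0 //.
apply/(dividesP AP (exh_neq0 gx _ _) (P_neq0 _)).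
by rewrite rmorphXn /= jP; apply: Hk.
Qed.

Section Cofree.
Variable r : nat.
Hypothesis le_rn : (r <= n)%N.
Hypothesis unbounded : forall i : 'I_n, (i < r)%N -> forall b, exists l, b < e l i.

(** The exponents decrease in [i] and grow with the span, so it is enough to make
    the one of index [r.-1] large. *)
Lemma exhaustion_large l (c : rat) : exists l',
  (forall i, in_span (g l') (g l i)) /\
  (forall i : 'I_n, (i < r)%N -> c <= e l' i).
Proof.
have [r0|r_gt0] := posnP r.
  exists l; split=> [i|i]; last by rewrite r0.
  by exists (fun i' => (i' == i)%:R); rewrite sum_delta.
have lt_r : (r.-1 < n)%N by rewrite prednK.
have [|l1 l1c] := unbounded (i := Ordinal lt_r) _ c; first by rewrite /= prednK.
have [l' [ll' l1l']] := exh_directed gx l l1; exists l'; split=> // i ir.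
apply: ltW; apply: lt_le_trans l1c _.
apply: le_trans (exhaustion_exponents_mono _ l1l') _.
by apply: (exh_anti gx); rewrite /= -ltnS prednK.
Qed.

Variable m : nat.
Hypothesis bounded : forall (i : 'I_n) l, (r <= i)%N -> e l i <= m%:R.

Let T := submod (multiples M (p ^ m)).

Let killed l (i : 'I_n) : (r <= i)%N -> P ^+ m *: g l i = 0.
Proof.
move=> ri; apply: exhaustion_ann.
by apply/(dividesP AP (exh_neq0 gx _ _) (P_neq0 _)); rewrite wPX bounded.
Qed.

Let val_T (t : T) : exists y : M, val t = P ^+ m *: y.
Proof.
case: t => t /= /asboolP [y ->]; exists y.
by rewrite -natrX scaler_nat.
Qed.

Let mem_T (y : M) : P ^+ m *: y \in multiples M (p ^ m).
Proof. by apply/asboolP; exists y; rewrite -natrX scaler_nat. Qed.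

(** Write [y], killed by [p ^ k], on generators whose first [r] exponents exceed [k]:
    each coefficient of such a generator is then divisible by [p], and the other
    generators are killed by [p ^ m]. *)
Lemma multiples_divisible (y : M) : exists y', P ^+ m *: y = P ^+ m *: y' *+ p.
Proof.
have [k yk] := exhaustion_torsion y.
have [l0 _] := exh_cover gx 0.
have [l1 l1e] := exhaustion_large l0 (k.+1)%:R.
have [l [l1l]] := exhaustion_absorbs l1 (fun _ : 'I_1 => y) => /(_ ord0) [a Ea].
have /choice [c Ec] : forall i, exists c,
    P ^+ m *: (a i *: g l i) = P ^+ m *: (P * c *: g l i).
  move=> i; have [ri|ir] := leqP r i.
    exists 0; rewrite !scalerA [P ^+ m * _]mulrC mulr0 mulr0 scale0r.
    by rewrite -scalerA killed ?scaler0.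
  suff [c Ec] : divides P (a i) by exists c; rewrite Ec mulrC.
  have /(exh_rel gx)/(_ i) : \sum_i (P ^+ k * a i) *: g l i = 0.
    rewrite -[RHS]yk Ea scaler_sumr; apply: eq_bigr => i' _; by rewrite scalerA.
  have [d Ed] : divides (P ^+ k.+1) (x l i).
    apply/(dividesP AP (P_neq0 _) (exh_neq0 gx _ _)); rewrite wPX.
    by apply: le_trans (l1e.2 i ir) _; apply: exhaustion_exponents_mono.
  move=> [d' Ed']; exists (d' * d); apply: (vringMI AP (P_neq0 k)).
  by rewrite Ed' Ed exprSr; ring.
exists (\sum_i c i *: g l i); rewrite -scaler_nat -/P Ea !scaler_sumr.
apply: eq_bigr => i _; rewrite Ec !scalerA; congr (_ *: _); ring.
Qed.

Lemma multiples_max_pdivisible : max_pdivisible p (multiples M (p ^ m)).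
Proof.
split.
  split; first by split; [exact: rpred0 | exact: rpredB].
  move=> y /asboolP [z ->]; have [z' Ez] := multiples_divisible z.
  exists (P ^+ m *: z'); first exact: mem_T.
  by rewrite -Ez -natrX scaler_nat.
move=> D [Dz Dp] y Dy; suff [z _ ->] : exists2 z, z \in D & y = z *+ p ^ m.
  by apply/asboolP; exists z.
elim: (m) => [|k [z Dz' ->]]; first by exists y.
have [z' Dz'' ->] := Dp _ Dz'; exists z' => //.
by rewrite -mulrnA expnS.
Qed.

(** A basis of the [p]-torsion of [p ^ m M] is made of the multiples of the first [r]
    generators by [x l i / p], at an index [l] where these exponents exceed [m]: the
    factor [p ^ m] then still divides [x l i / p]. *)
Theorem multiples_cofree (Q : lmodType A) (pi : L -> Q) :
  field_mod_ring j pi -> lmod_isom T {ffun 'I_r -> Q}.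
Proof.
move=> piP; have [l0 _] := exh_cover gx 0.
have [l [_ le]] := exhaustion_large l0 (m.+1)%:R.
have /choice [c Ec] : forall i : 'I_r, divides (P ^+ m.+1) (x l (widen_ord le_rn i)).
  move=> i; apply/(dividesP AP (P_neq0 _) (exh_neq0 gx _ _)).
  by rewrite wPX le /=.
pose gT l (i : 'I_r) : T := Submod (mem_T (g l (widen_ord le_rn i))).
pose b (i : 'I_r) : T := c i *: gT l i.
apply: (divisible_cofree (b := b) AP p_neq0 wp_gt0 piP).
- move=> t; have [y Ey] := val_T t; have [y' Ey'] := multiples_divisible y.
  by exists (Submod (mem_T y')); apply: val_inj; rewrite raddfMn Ey.
- move=> t; have [k Ek] := exhaustion_torsion (val t); exists k.
  by apply: val_inj; rewrite raddfMn raddf0 -Ek -natrX scaler_nat.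
- move=> h; have [y Ey] := choice (fun i => val_T (h i)).
  have [l' [_ hl']] := exhaustion_absorbs l y; exists (gT l') => i.
  have [a Ea] := in_span_scale le_rn (killed l') (hl' i).
  by exists a; apply: val_inj; rewrite Ey Ea raddf_sum; apply: eq_bigr.
- move=> a.
  have E : val (\sum_i a i *: b i) =
      \sum_i a i *: ((c i * P ^+ m) *: g l (widen_ord le_rn i)).
    rewrite raddf_sum; apply: eq_bigr => i _.
    by rewrite -!scalerA.
  split=> [a0|dvd].
    move: E; rewrite a0 raddf0 => /esym/exhaustion_rel_prefix dvd i.
    have [d Ed] := dvd i; exists d; move: Ed; rewrite Ec => Ed.
    have c0 : c i != 0.
      apply: contra_neq (exh_neq0 gx l (widen_ord le_rn i)) => c0.
      by rewrite Ec c0 mul0r.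
    have cP : c i * P ^+ m != 0.
      by rewrite -(vring_eq0 AP) rmorphM mulf_neq0 ?(vring_eq0 AP).
    apply: (vringMI AP cP); rewrite mulrC Ed exprS; ring.
  apply: val_inj; rewrite E raddf0; apply/exhaustion_rel_prefix => i.
  by have [d ->] := dvd i; exists d; rewrite Ec exprS; ring.
Qed.

End Cofree.

(** If the exponents of index [i0] were bounded by [m], the [n] generators at [l0], all
    divisible by [p ^ m], would lie in the span of the [i0 < n] elements
    [p ^ m g l c], [c < i0], for some [l]; but they have no primitive relation since
    their annihilators are proper ideals. *)
Theorem divisible_unbounded (i0 : 'I_n) l0 :
  (forall y : M, exists y', y = y' *+ p) -> (forall i, 0 < e l0 i) ->
  forall m : nat, exists l, m%:R < e l i0.
Proof.
move=> Mdiv l0_gt0 m; apply: contrapT => /forallNP small.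
have {}small l : e l i0 <= m%:R by rewrite leNgt; apply/negP/small.
have Mdivm (y : M) : exists y', y = P ^+ m *: y'.
  elim: m {small} y => [|k IH] y; first by exists y; rewrite scale1r.
  have [y1 ->] := IH y; have [y2 ->] := Mdiv y1; exists y2.
  by rewrite exprSr -scalerA scaler_nat.
have [h Eh] := choice (fun i => Mdivm (g l0 i)).
have [l [_ hl]] := exhaustion_absorbs l0 h.
have killed (i : 'I_n) : (i0 <= i)%N -> P ^+ m *: g l i = 0.
  move=> ii0; apply: exhaustion_ann.
  apply/(dividesP AP (exh_neq0 gx _ _) (P_neq0 _)); rewrite wPX.
  by apply: le_trans (small l); apply: (exh_anti gx).
have [i|u /(exh_rel gx) dvd [i ui]] := @relation_in_span _ _ _ _ AP M n i0 (g l0)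
  (fun c => P ^+ m *: g l (widen_ord (ltnW (ltn_ord i0)) c)) (ltn_ord i0).
  by rewrite Eh; apply: in_span_scale.
have := dvd i; rewrite ui => /(dividesP AP (exh_neq0 gx _ _) (oner_neq0 _)).
by rewrite rmorph1 (valuation1 wP) leNgt l0_gt0.
Qed.

End Systems.

(** * Integral elements and the extended valuation *)

Section ValuationRingOfK.
Variables (K : fieldType) (v : discreteValuation K).
Local Notation O := (val_ring v).

Variable t : K.
Hypotheses (t_neq0 : t != 0) (vt : v t = 1).

Lemma val_ge_uniformizer N y : y \in val_ge v N%:Z ->
  exists d : O, y = t ^+ N * val d.
Proof.
move=> yN; have tN0 : t ^+ N != 0 by rewrite expf_neq0.
have dP : y / t ^+ N \in val_ge v 0.
  move: yN; rewrite !inE mulf_eq0 invr_eq0 (negPf tN0) orbF.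
  have [//|y0 /=] := eqVneq y 0.
  rewrite (valuationM (dval_axioms v)) ?invr_eq0 // (valuationV (dval_axioms v)) //.
  by rewrite (valuationX (dval_axioms v)) // vt natz subr_ge0.
by exists (ValRing dP); rewrite /= mulrC divfK.
Qed.

Lemma val_ge_expM N (d : O) : t ^+ N * val d \in val_ge v N%:Z.
Proof.
rewrite -[N%:Z]addr0 val_geM ?(valP d) // inE (valuationX (dval_axioms v)) //.
by rewrite vt natz lexx orbT.
Qed.

(** Completeness, with the rate of convergence of the partial sums of a series in the
    powers of a uniformizer. *)
Lemma adic_series_converges (T : O) : val T = t -> val_complete v ->
  forall c : nat -> O, exists l : O, forall N, exists d : O,
    l - \sum_(i < N) T ^+ i * c i = T ^+ N * d.
Proof.
move=> ET vcomp c; pose u N : K := val (\sum_(i < N) T ^+ i * c i).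
have uS N m : u (m + N)%N - u N \in val_ge v N%:Z.
  have [d Ed] : exists d : O, u (m + N)%N - u N = t ^+ N * val d.
    rewrite /u -raddfB /= -!(big_mkord xpredT (fun i => T ^+ i * c i)).
    rewrite (@big_cat_nat _ _ _ N 0 (m + N)) ?leq_addl //= addrC addKr.
    exists (\sum_(N <= i < m + N) T ^+ (i - N) * c i).
    have -> : t ^+ N = val (T ^+ N) by rewrite rmorphXn /= ET.
    rewrite -rmorphM mulr_sumr; congr val; rewrite !big_nat.
    by apply: eq_bigr => i /andP[Ni _]; rewrite mulrA -exprD subnKC.
  by rewrite Ed val_ge_expM.
have uN N i : (N <= i)%N -> u i - u N \in val_ge v N%:Z.
  by move=> /subnK <-; apply: uS.
have weaken m (N : nat) y : (m <= N%:Z) -> y \in val_ge v N%:Z -> y \in val_ge v m.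
  by move=> mN; rewrite !inE => /orP[->//|/(le_trans mN)->]; rewrite orbT.
have [|l Hl] := vcomp u.
  move=> m; exists `|m|%N => i k mi mk; apply: (weaken _ `|m|%N); first exact: lez_abs.
  rewrite -[u i](subrK (u `|m|%N)) -addrA -[_ + - u k]opprB opprB.
  rewrite -[u `|m|%N - u k]opprB; apply: val_geB; exact: uN.
have luN N : l - u N \in val_ge v N%:Z.
  have [N1 HN1] := Hl N%:Z.
  rewrite -[l - u N](_ : (u (maxn N N1) - u N) - (u (maxn N N1) - l) = _); last by ring.
  by apply: val_geB; [apply: uN; rewrite leq_maxl | apply: HN1; rewrite leq_maxr].
have l0 : l \in val_ge v 0 by have := luN 0%N; rewrite /u big_ord0 subr0.
exists (ValRing l0) => N; have [d Ed] := val_ge_uniformizer (luN N).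
by exists d; apply: val_inj; rewrite rmorphB rmorphM rmorphXn /= ET -Ed.
Qed.

Lemma poly_divisible (T : O) N (q : {poly O}) :
  (forall i, exists d, q`_i = T ^+ N * d) -> exists s, q = T ^+ N *: s.
Proof.
move=> /choice [d Ed]; exists (\poly_(i < size q) d i); apply/polyP => i.
rewrite coefZ coef_poly; case: ltnP => [_|/(nth_default 0) ->]; first exact: Ed.
by rewrite mulr0.
Qed.

End ValuationRingOfK.

Section Integrality.
Variables (p : nat) (K L : fieldType) (v : discreteValuation K).
Variables (iota : {rmorphism K -> L}) (w : L -> rat).
Hypothesis locK : local_field p v.
Hypothesis wvp : padic_valuation v iota p w.
Local Notation O := (val_ring v).

Let wP : valuation_axioms w. Proof. by case: wvp. Qed.

Lemma natr_neq0 q : prime q -> (q%:R : K) != 0.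
Proof.
move=> q_pr; apply/negP => /eqP q0; have := local_char0 locK q.
by rewrite !inE q_pr q0 eqxx.
Qed.

Lemma residue_char_prime : prime p.
Proof. by have := local_residue_char locK; rewrite inE => /andP[]. Qed.

Lemma val_p_gt0 : 0 < v p%:R.
Proof.
have /andP[_ /eqP p0] := local_residue_char locK.
have : (p%:R : O) \in @max_ideal K v.
  rewrite -[p%:R]subr0 Quotient.idealrBE; apply/eqP.
  by rewrite rmorph_nat rmorph0.
rewrite !inE rmorph_nat (negPf (natr_neq0 residue_char_prime)) /=.
by move=> /(lt_le_trans _)->.
Qed.

Lemma w_iota a : a != 0 -> w (iota a) = (v a)%:~R / (v p%:R)%:~R.
Proof. by case: wvp => _; apply. Qed.

Lemma w_p : w p%:R = 1.
Proof.
rewrite -(rmorph_nat iota) w_iota ?natr_neq0 ?residue_char_prime //.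
by rewrite divff // intr_eq0 gt_eqF ?val_p_gt0.
Qed.

Let h : {rmorphism O -> L} := iota \o (val : O -> K).

Lemma w_base_ge0 (a : O) : h a \in vge w 0.
Proof.
rewrite inE /= fmorph_eq0; have [//|a0 /=] := eqVneq (val a) 0.
rewrite w_iota // divr_ge0 // ler0z; last exact/ltW/val_p_gt0.
by have := valP a; rewrite inE /= (negPf a0).
Qed.

Lemma vge0_exp x k : x \in vge w 0 -> x ^+ k \in vge w 0.
Proof.
move=> x0; elim: k => [|k IH]; last by rewrite exprS -[0]addr0 vgeM.
by rewrite inE (valuation1 wP) lexx orbT.
Qed.

(** Multiplied by a power of [y := x^-1], an integral equation of [x] expresses [1]
    through positive powers of [y], so [w y] cannot be positive. *)
Lemma integral_vge0 x : integral v iota x -> x \in vge w 0.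
Proof.
case=> q q_mon /rootP; rewrite -[map_poly _ q]/(map_poly h q) => qx0.
rewrite inE; have [//|x0 /=] := eqVneq x 0.
rewrite leNgt; apply/negP => wx_lt0; pose y := x^-1.
have y0 : y != 0 by rewrite invr_eq0.
have wy : 0 < w y by rewrite (valuationV wP) // oppr_gt0.
have yge : y \in vge w 0 by rewrite inE (ltW wy) orbT.
suff : 1 \in vge w (w y) by rewrite inE oner_eq0 (valuation1 wP) leNgt wy.
set n := (size q).-1.
have sq : size q = n.+1 by rewrite prednK // lt0n size_poly_eq0 monic_neq0.
have /(congr1 (fun z => z * y ^+ n)) := qx0.
rewrite (@horner_coef_wide _ n.+1) ?mul0r; last first.
  by rewrite -sq size_map_poly_id0 ?(monicP q_mon) ?rmorph1 ?oner_eq0.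
rewrite big_ord_recr mulrDl mulr_suml.
have -> : (map_poly h q)`_n = 1.
  rewrite coef_map -[n]/((size q).-1) -lead_coefE (monicP q_mon); exact: rmorph1.
rewrite mul1r -exprMn divff // expr1n => /eqP; rewrite addr_eq0 => /eqP/esym E.
rewrite -[1]opprK E -mulN1r -[w y]add0r; apply: (vgeM wP).
  by have := w_base_ge0 (-1); rewrite rmorphN1.
apply: (vge_sum wP) => i _; rewrite -mulrA.
have -> : x ^+ i * y ^+ n = y * y ^+ (n - i).-1.
  rewrite -exprS prednK ?subn_gt0 // -[y ^+ n](_ : y ^+ i * y ^+ (n - i) = _).
    by rewrite mulrA -exprMn divff // expr1n mul1r.
  by rewrite -exprD subnKC // ltnW.
rewrite -[w y]add0r coef_map; apply: (vgeM wP); first exact: w_base_ge0.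
by rewrite -[w y]addr0; apply: (vgeM wP); [rewrite inE lexx orbT | apply: vge0_exp].
Qed.

(** Dividing an equation of [x] by its last coefficient of least valuation: the
    coefficient of index [k] becomes [1] and the next ones lie in the maximal
    ideal. *)
Lemma primitive_equation x : algebraicOver iota x -> exists2 f : {poly O},
  root (map_poly h f) x & exists k, f`_k = 1 /\
    forall i, (k < i)%N -> (0 < v (val f`_i)) || (val f`_i == 0).
Proof.
case=> q q0 qx0.
have lc0 : lead_coef q != 0 by rewrite lead_coef_eq0.
have sq : (size q > 0)%N by rewrite lt0n size_poly_eq0.
have lastP : ((size q).-1 < size q)%N by rewrite prednK.
case: (@arg_minP _ _ _ (Ordinal lastP) (fun i => q`_i != 0)
  (fun i : 'I_(size q) => v q`_i)) => [|i0 qi0 i0min]; first by rewrite /= -lead_coefE.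
case: (@arg_maxnP _ i0 (fun i => (q`_i != 0) && (v q`_i == v q`_i0))
  (fun i : 'I_(size q) => i : nat)) => [|k /andP[qk /eqP vk] kmax].
  by rewrite qi0 eqxx.
have vq i : q`_i != 0 -> v q`_k <= v q`_i.
  move=> qi; have ilt : (i < size q)%N.
    by rewrite ltnNge; apply: contra qi => /(nth_default 0)->.
  by have := i0min (Ordinal ilt) qi; rewrite vk.
have qO i : q`_i / q`_k \in val_ge v 0.
  rewrite inE mulf_eq0 invr_eq0 (negPf qk) orbF.
  have [//|qi /=] := eqVneq q`_i 0.
  rewrite (valuationM (dval_axioms v)) ?invr_eq0 // (valuationV (dval_axioms v)) //.
  by rewrite subr_ge0 vq.
pose f := \poly_(i < size q) (ValRing (qO i)).
have fE i : val f`_i = q`_i / q`_k.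
  by rewrite coef_poly; case: ltnP => // /(nth_default 0)->; rewrite mul0r.
exists f.
  have -> : map_poly h f = (iota q`_k)^-1 *: map_poly iota q.
    apply/polyP => i.
    by rewrite coef_map /= fE coefZ coef_map rmorphM fmorphV mulrC.
  by rewrite rootZ ?invr_eq0 ?fmorph_eq0.
exists k; split; first by apply: val_inj; rewrite fE divff // rmorph1.
move=> i ki; rewrite fE mulf_eq0 invr_eq0 (negPf qk) orbF.
have [|qi] := eqVneq q`_i 0; first by rewrite orbT.
rewrite orbF (valuationM (dval_axioms v)) ?invr_eq0 // (valuationV (dval_axioms v)) //.
rewrite subr_gt0 lt_neqAle vq // andbT.
apply: contraL ki => /eqP vki; rewrite -leqNgt.
have ilt : (i < size q)%N.
  by rewrite ltnNge; apply: contra qi => /(nth_default 0)->.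
by apply: (kmax (Ordinal ilt)); rewrite qi -vki vk eqxx.
Qed.

(** In a primitive equation [f] of [x], the part of degree at most [k] is a monic
    polynomial [g], and [f - g] is divisible by the uniformizer [T]. Division by [g]
    writes every polynomial in [x] as one of degree less than [k] plus [T] times
    another. Iterating from [x ^ k], the parts of low degree add up, by completeness,
    to a polynomial [C] over the base ring, and [x ^ k - C(x)] is divisible by every
    power of [T]. Since [w x] is nonnegative, the cofactors stay in the ring of [w],
    so [x ^ k - C(x) = 0] by the archimedean property. *)
Lemma vge0_integral x : algebraicOver iota x -> x \in vge w 0 -> integral v iota x.
Proof.
move=> x_alg x_ge0; have [f fx [k [fk f_gt]]] := primitive_equation x_alg.
have [t t0 vt] := dval_uniformizer v.
have tO : t \in val_ge v 0 by rewrite inE vt orbT.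
pose T : O := ValRing tO.
pose ev (q : {poly O}) := (map_poly h q).[x].
have evD (q q' : {poly O}) : ev (q + q') = ev q + ev q' by rewrite /ev rmorphD hornerD.
have evB (q q' : {poly O}) : ev (q - q') = ev q - ev q'.
  by rewrite /ev rmorphB hornerD hornerN.
have evM (q q' : {poly O}) : ev (q * q') = ev q * ev q' by rewrite /ev rmorphM hornerM.
have evZ a (q : {poly O}) : ev (a *: q) = h a * ev q by rewrite /ev map_polyZ hornerZ.
have ev_ge0 q : ev q \in vge w 0.
  rewrite /ev horner_coef; apply: (vge_sum wP) => i _.
  rewrite coef_map -[X in vge w X]addr0.
  by apply: (vgeM wP); [exact: w_base_ge0 | exact: vge0_exp].
pose g : {poly O} := 'X^k + \poly_(i < k) f`_i.
have g_mon : g \is monic.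
  by rewrite monicE lead_coefDl ?lead_coefXn // size_polyXn ltnS size_poly.
have sg : size g = k.+1 by rewrite size_addl size_polyXn // ltnS size_poly.
have [s Es] : exists s, f - g = T ^+ 1 *: s.
  apply: poly_divisible => i; rewrite coefB coefD coefXn coef_poly.
  have [ik|ki|->] := ltngtP i k; first by exists 0; rewrite add0r subrr mulr0.
    have [|d Ed] := @val_ge_uniformizer _ _ _ t0 vt 1 (val f`_i).
      by rewrite inE orbC; exact: f_gt.
    by exists d; apply: val_inj; rewrite rmorphM rmorphXn /= -Ed addr0 subr0.
  by exists 0; rewrite fk addr0 subrr mulr0.
have /choice [c /choice [Q EQ]] (q : {poly O}) :
    exists c q' : {poly O}, (size c <= k)%N /\ ev q = ev c + h T * ev q'.
  exists (Pdiv.Ring.rmodp q g), (- (Pdiv.Ring.rdivp q g * s)); split.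
    by rewrite -ltnS -sg Pdiv.Ring.ltn_rmodpN0 // monic_neq0.
  rewrite {1}(Pdiv.RingMonic.rdivp_eq g_mon q) evD evM addrC.
  have -> : ev g = - (h T * ev s).
    by apply/eqP; rewrite -addr_eq0 -evZ -[T]expr1 -Es evB addrC subrK [ev f](rootP fx).
  have -> : ev (- (Pdiv.Ring.rdivp q g * s)) = - (ev (Pdiv.Ring.rdivp q g) * ev s).
    by rewrite -evM /ev rmorphN hornerN.
  by congr (_ + _); ring.
pose R i := iter i Q 'X^k.
have ERN N : ev 'X^k = ev (\sum_(i < N) T ^+ i *: c (R i)) + h T ^+ N * ev (R N).
  elim: N => [|N IH]; first by rewrite big_ord0 /ev rmorph0 horner0 mul1r add0r.
  rewrite IH big_ord_recr evD evZ rmorphXn -addrA; congr (_ + _).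
  by rewrite [in LHS](EQ (R N)).2 mulrDr mulrA -exprSr.
have [l Hl] := choice (fun n => adic_series_converges t0 vt (erefl : val T = t)
  (local_complete locK) (fun i => (c (R i))`_n)).
pose C := \poly_(n < k) l n.
have limit N : exists s', C - \sum_(i < N) T ^+ i *: c (R i) = T ^+ N *: s'.
  apply: poly_divisible => n; have [d Ed] := Hl n N.
  rewrite coefB coef_sum coef_poly; case: ltnP => [_|kn].
    exists d; rewrite -Ed; congr (_ - _); apply: eq_bigr => i _.
    by rewrite coefZ.
  exists 0; rewrite mulr0 sub0r big1 ?oppr0 // => i _.
  by rewrite coefZ nth_default ?mulr0 // (leq_trans (EQ (R i)).1).
exists ('X^k - C).
  rewrite monicE lead_coefDl ?lead_coefXn // size_polyXn size_opp ltnS.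
  exact: size_poly.
apply/rootP; rewrite -/h -/(ev ('X^k - C)); apply/eqP/negPn/negP => z0.
have hT0 : h T != 0 by rewrite fmorph_eq0.
have wT : w (h T) = (v p%:R)%:~R^-1 by rewrite /h /= w_iota // vt mul1r.
have vp0 : 0 < (v p%:R)%:~R :> rat by rewrite ltr0z val_p_gt0.
have bound (N : nat) : N%:R * w (h T) <= w (ev ('X^k - C)).
  have : ev ('X^k - C) \in vge w (N%:R * w (h T)).
    have [s' Es'] := limit N.
    have -> : ev ('X^k - C) = h T ^+ N * ev (R N - s').
      have EC : ev C = ev (\sum_(i < N) T ^+ i *: c (R i)) + h T ^+ N * ev s'.
        by rewrite -rmorphXn -evZ -evD -Es' addrC subrK.
      by rewrite !evB EC (ERN N); ring.
    rewrite -[_ * w _]addr0; apply: (vgeM wP) => //.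
    by rewrite inE (valuationX wP) // mulr_natl lexx orbT.
  by rewrite inE (negPf z0).
have := bound (Num.bound `|w (ev ('X^k - C)) * (v p%:R)%:~R|).
rewrite wT ler_pdivrMr // leNgt => /negP; apply.
by apply: le_lt_trans (ler_norm _) _; apply: archi_boundP.
Qed.

Hypothesis L_alg : forall x : L, algebraicOver iota x.

Lemma integers_valuation_ring :
  valuation_ring (val : integers v (full_subext iota) -> L) w.
Proof.
split=> [//||x]; first exact: val_inj.
split=> [x0|[a <-]].
  have xP : x \in integers_pred v (full_subext iota).
    by rewrite inE; apply/asboolP/vge0_integral.
  by exists (Integers xP).
by apply: integral_vge0; have /andP[_ /asboolP] := valP a.
Qed.

End Integrality.

(** * Relations detected by a tensor product *)

Section QuotientModule.
Variables (R : pzRingType) (V : lmodType R) (N : submodClosed V).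

Lemma lquot_piZ a x : lquot_pi N (a *: x) = a *: lquot_pi N x.
Proof. exact: esym (lquot_scale_pi N a x). Qed.

Lemma lquot_pi0 : lquot_pi N 0 = 0.
Proof. exact: (raddf0 (\pi_({ideal_quot submod_group N}))%qT). Qed.

Lemma lquot_pi_eq x y : lquot_pi N x = lquot_pi N y <-> x - y \in N.
Proof.
rewrite -[x - y \in N]/(x - y \in submod_group N) Quotient.idealrBE.
by split=> [/eqP|/eqP].
Qed.

Lemma lquot_pi_eq0 x : lquot_pi N x = 0 <-> x \in N.
Proof. by rewrite -lquot_pi0 lquot_pi_eq subr0. Qed.

End QuotientModule.

Section TensorRelations.
Local Open Scope quotient_scope.
Variables (R A : comNzRingType) (f : {rmorphism R -> A}) (V : lmodType R).

(** The universal property of the tensor product, on formal sums. *)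
Lemma tens_rel_sum (W : lmodType A) (psi : V -> W) (s t : seq (A * V)) :
  {morph psi : u v / u + v} -> (forall a u, psi (a *: u) = f a *: psi u) ->
  tens_rel f s t ->
  \sum_(u <- s) u.1 *: psi u.2 = \sum_(u <- t) u.1 *: psi u.2.
Proof.
move=> psiD psiZ; elim=> {s t} //=.
- by move=> s t u _ -> _ ->.
- by move=> u s t _ IH; rewrite !big_cons IH.
- by move=> s t st; apply: perm_big.
- by move=> u s; rewrite big_cons scale0r add0r.
- by move=> a b u s; rewrite !big_cons /= scalerDl addrA.
- by move=> a u u' s; rewrite !big_cons /= psiD scalerDr addrA.
- by move=> a b u s; rewrite !big_cons /= psiZ scalerA.
Qed.

(** By injectivity a relation in [W] is already one in the tensor product. There it is
    tested by the semilinear form [psi] with values in [A / f (x i0)] that takes the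
    coordinate of index [i0]. *)
Lemma tensor_diagonal_relations (W : lmodType A) (h : V -> W) n
    (b : 'I_n -> V) (x : 'I_n -> R) (a : 'I_n -> A) :
  {morph h : u v / u + v} -> (forall c u, h (c *: u) = f c *: h u) ->
  injective (@tensor_lift _ _ f V W h) ->
  diagonal_relations b x -> (forall u, in_span b u) ->
  \sum_i a i *: h (b i) = 0 -> forall i, divides (f (x i)) (a i).
Proof.
move=> hD hZ h_inj bx b_gen ab0 i0.
have lift_pi s : @tensor_lift _ _ f V W h (\pi_({eq_quot tens_eqb f (V:=V)}) s) =
    \sum_(u <- s) u.1 *: h u.2.
  apply: tens_rel_sum => //; apply/asboolP.
  by have /eqquotP := reprK (\pi_({eq_quot tens_eqb f (V:=V)}) s).
pose s := [seq (a i, b i) | i <- index_enum 'I_n].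
have : tens_rel f s [::].
  apply/asboolP; apply/(@eqquotP _ (tens_equiv f V)).
  by apply: h_inj; rewrite !lift_pi big_nil big_map.
have [c Ec] := choice b_gen.
pose psi u : lquot (pideal (f (x i0))) := lquot_pi (pideal (f (x i0))) (f (c u i0)).
have psiE u (d : 'I_n -> R) : u = \sum_i d i *: b i ->
    psi u = lquot_pi (pideal (f (x i0))) (f (d i0)).
  move=> Eu; apply/lquot_pi_eq/asboolP.
  have /bx/(_ i0) [q Eq] : \sum_i (c u i - d i) *: b i = 0.
    under eq_bigr => i _ do rewrite scalerBl.
    by rewrite sumrB -Ec -Eu subrr.
  by exists (f q); rewrite -rmorphB Eq rmorphM.
have psiD : {morph psi : u u' / u + u'}.
  move=> u u'; rewrite (psiE _ (fun i => c u i + c u' i)); last first.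
    rewrite {1}(Ec u) {1}(Ec u') -big_split; apply: eq_bigr => i _.
    by rewrite scalerDl.
  by rewrite rmorphD lquot_piD.
have psiZ r u : psi (r *: u) = f r *: psi u.
  rewrite (psiE _ (fun i => r * c u i)); last first.
    rewrite {1}(Ec u) scaler_sumr; apply: eq_bigr => i _.
    by rewrite scalerA.
  by rewrite rmorphM -lquot_piZ.
move=> /(tens_rel_sum psiD psiZ); rewrite big_nil big_map.
rewrite (bigD1 i0) //= (psiE (b i0) (fun i => (i == i0)%:R)); last first.
  by rewrite sum_delta.
rewrite big1 ?addr0 => [|i ii0]; last first.
  rewrite (psiE (b i) (fun i' => (i' == i)%:R)); last first.
    by rewrite sum_delta.
  by rewrite eq_sym (negPf ii0) rmorph0 lquot_pi0 scaler0.
rewrite eqxx rmorph1 -lquot_piZ => /lquot_pi_eq0/asboolP [q Eq]; exists q.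
by rewrite -Eq; apply: esym; apply: mulr1.
Qed.

End TensorRelations.

Lemma cyclic_decomposition_basis (R : comNzRingType) (V : lmodType R) n
    (x : 'I_n -> R) : cyclic_decomposition V x ->
  exists b : 'I_n -> V, diagonal_relations b x /\ forall u, in_span b u.
Proof.
case=> phi phiP.
pose one i : lquot (pideal (x i)) := lquot_pi (pideal (x i)) (1 : R^o).
have /choice [b Eb] : forall i, exists u, forall i', phi i' u = one i' *+ (i' == i).
  by move=> i; have [u [Eu _]] := phiP (fun i' => one i' *+ (i' == i)); exists u.
have phi_inj u u' : (forall i, phi i u = phi i u') -> u = u'.
  move=> E; have [z [_ zu]] := phiP (fun i => phi i u').
  by rewrite -(zu u) // -(zu u').
have phiS a i : phi i (\sum_i a i *: b i) = a i *: one i.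
  rewrite raddf_sum (bigD1 i) //= linearZ Eb eqxx big1 ?addr0 // => i' i'i.
  by rewrite linearZ Eb eq_sym (negPf i'i) /= scaler0.
have oneE i a : a *: one i = lquot_pi (pideal (x i)) (a : R^o).
  by rewrite -lquot_piZ; congr lquot_pi; apply: mulr1.
exists b; split=> [a|u].
  split=> [ab0 i|dvd].
    have := phiS a i; rewrite ab0 raddf0 oneE.
    by move=> /esym/lquot_pi_eq0/asboolP [q Eq]; exists q.
  apply: phi_inj => i; rewrite phiS raddf0 oneE; apply/lquot_pi_eq0.
  by apply/asboolP; have [q Eq] := dvd i; exists q.
exists (fun i => repr (phi i u : {ideal_quot submod_group (pideal (x i))}%qT)).
by apply: phi_inj => i; rewrite phiS oneE lquot_piK.
Qed.

(** * Direct systems as exhaustions *)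

Section DirectSystem.
Variables (p : nat) (K L : fieldType) (v : discreteValuation K).
Variables (iota : {rmorphism K -> L}) (M : lmodType (ring_of_integers v iota)).
Variables (n : nat) (w : L -> rat) (D : direct_system M).
Variable e : ds_index D -> 'I_n -> rat.
Local Notation O := (ring_of_integers v iota).

Hypothesis locK : local_field p v.
Hypothesis L_alg : forall x : L, algebraicOver iota x.
Hypothesis wvp : padic_valuation v iota p w.
Hypothesis e_anti : forall l (i i' : 'I_n), (i <= i')%N -> e l i' <= e l i.

Let wP : valuation_axioms w. Proof. by case: wvp. Qed.

Let to_O (l : ds_index D) : integers v (ds_field l) -> O :=
  integers_incl (@sub_full_subext _ _ iota (ds_field l)).

Lemma ds_field_absorbs (l : ds_index D) s (y : 'I_s -> L) :
  exists l' : ds_index D, (l <= l')%O /\ forall i, y i \in ds_field l'.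
Proof.
elim: s y => [|s IH] y; first by exists l; split=> // -[].
have [l1 [ll1 yl1]] := IH (fun i => y (lift ord0 i)).
have [l2 yl2] := ds_field_cover D (y ord0).
have [l' [l1l' l2l']] := ds_directed l1 l2; exists l'.
have incl k : (k <= l')%O -> {subset ds_field k <= ds_field l'}.
  by rewrite le_eqVlt => /orP[/eqP-> //|]; apply: ds_field_incl.
split=> [|i]; first exact: le_trans l1l'.
by case: (unliftP ord0 i) => [i'|] ->; [exact: (incl l1) | exact: (incl l2)].
Qed.

(** A relation over the integers of [L] between the generators of a stage [l] has its
    coefficients in the field of a later stage [l'], where the injectivity of the
    extension of scalars from [l] to [l'] makes it diagonal. *)
Lemma ds_exhaustion (b : forall l : ds_index D, 'I_n -> submod (ds_module l))
    (x : forall l : ds_index D, 'I_n -> integers v (ds_field l)) :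
  (forall l, diagonal_relations (b l) (x l)) ->
  (forall l u, in_span (b l) u) ->
  (forall l i, x l i != 0) -> (forall l i, w (val (x l i)) = e l i) ->
  exhaustion (val : O -> L) w (fun l i => val (b l i) : M) (fun l i => to_O (x l i)).
Proof.
move=> bx b_gen x0 wx.
have spanM (l : ds_index D) (y : M) : y \in (ds_module l : {pred M}) ->
    in_span (fun i => val (b l i) : M) y.
  move=> yl; have [a Ea] := b_gen l (Submod yl); exists (fun i => to_O (a i)).
  by rewrite -[LHS]/(val (Submod yl)) Ea raddf_sum; apply: eq_bigr.
split=> [l i|l i i' ii'|l a|y|l l'].
- by apply: contra (x0 l i) => /eqP/(congr1 val) /= xi0; apply/eqP/val_inj.
- by rewrite /= !wx e_anti.
- split=> [ab0|]; last first.
    move=> dvd; apply: big1 => i _; have [q ->] := dvd i; rewrite -scalerA.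
    have /(congr1 val) : x l i *: b l i = 0.
      by apply: (diagonal_relations_ann (bx l)); exists 1; rewrite mul1r.
    by move=> /= E; rewrite [X in q *: X]E scaler0.
  have [l' [ll' al']] := ds_field_absorbs l (fun i => val (a i)).
  have aP i : val (a i) \in integers_pred v (ds_field l').
    by rewrite inE al' /=; have /andP[] := valP (a i).
  pose a' i : integers v (ds_field l') := Integers (aP i).
  have aE i : a i = to_O (a' i) by apply: val_inj.
  move: ll'; rewrite le_eqVlt => /orP[/eqP ll'|ll'].
    move: al' aP a' aE; rewrite -ll' => al' aP a' aE.
    have /bx dvd : \sum_i a' i *: b l i = 0.
      apply: val_inj; rewrite raddf_sum raddf0 -[RHS]ab0; apply: eq_bigr => i' _.
      by rewrite aE.
    move=> i; have [q Eq] := dvd i; exists (to_O q); apply: val_inj.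
    by rewrite aE Eq.
  have := tensor_diagonal_relations _ _
    (@ds_tensor_inj _ _ _ _ _ D l l' ll') (bx l) (b_gen l).
  move=> /(_ a') dvd i; case: (dvd _ _ _ i) => [u u'|c u||q Eq].
  + by apply: val_inj.
  + apply: val_inj; have E : to_O c = to_O (integers_incl (ds_field_incl ll') c).
      exact: val_inj.
    (* both sides are scalar products in [M], by integers of [L] *)
    change (to_O c *: (val u : M) =
      to_O (integers_incl (ds_field_incl ll') c) *: (val u : M)).
    by rewrite E.
  + apply: val_inj; rewrite raddf_sum raddf0 -[RHS]ab0; apply: eq_bigr => i' _.
    by rewrite aE.
  by exists (to_O q); apply: val_inj; rewrite aE Eq.
- by have [l yl] := ds_module_cover D y; exists l; apply: spanM.
have [k [lk l'k]] := ds_directed l l'; exists k.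
have incl l1 i : (l1 <= k)%O -> in_span (fun i => val (b k i) : M) (val (b l1 i)).
  rewrite le_eqVlt => /orP[/eqP->|l1k]; apply: spanM; first exact: valP.
  exact: (ds_module_incl l1k) (valP (b l1 i)).
by split=> i; apply: incl.
Qed.

(** A stage with a zero exponent has its last generator equal to [0], hence is
    generated by [n.-1] elements; as [n] is the least upper bound of the numbers of
    generators, not all stages are of this kind. *)
Lemma positive_exponents (b : forall l : ds_index D, 'I_n -> submod (ds_module l))
    (x : forall l : ds_index D, 'I_n -> integers v (ds_field l)) :
  (forall l, diagonal_relations (b l) (x l)) ->
  (forall l u, in_span (b l) u) ->
  (forall l i, x l i != 0) -> (forall l i, w (val (x l i)) = e l i) ->
  (forall l i, 0 <= e l i) -> ds_sup_gens D n -> (0 < n)%N ->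
  exists l, forall i, 0 < e l i.
Proof.
move=> bx b_gen x0 wx e0 [_ n_min] n_gt0; apply: contrapT => /forallNP none.
suff : (n <= n.-1)%N by rewrite -ltnS prednK // ltnn.
apply: n_min => l k [_ k_min]; apply: k_min.
have lt_n : (n.-1 < n)%N by rewrite prednK.
pose i0 := Ordinal lt_n.
have w0 : w (val (x l i0)) = 0.
  have /existsNP [i /negP] := none l; rewrite -leNgt => ei.
  apply: le_anti; rewrite wx e0 andbT; apply: le_trans ei; apply: e_anti.
  by rewrite /= -ltnS prednK.
have vx0 : val (x l i0) != 0 by apply: contra (x0 l i0) => /eqP E; apply/eqP/val_inj.
have uP : (val (x l i0))^-1 \in integers_pred v (ds_field l).
  have [F1 _ FM] := subext_divring (ds_field l).
  rewrite inE; apply/andP; split.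
    by rewrite -[_^-1]mul1r FM //; have /andP[] := valP (x l i0).
  apply/asboolP/(vge0_integral locK wvp) => //.
  by rewrite inE (valuationV wP) // w0 oppr0 lexx orbT.
have b0 : b l i0 = 0.
  rewrite -[b l i0]scale1r; apply: (diagonal_relations_ann (bx l)).
  by exists (Integers uP); apply: val_inj; rewrite /= mulVf.
have le_n := leq_pred n.
exists (fun i => 1 *: b l (widen_ord le_n i)) => u; rewrite -[u]scale1r.
apply: in_span_scale => [i ni|]; last exact: b_gen.
rewrite (_ : i = i0) ?b0 ?scaler0 //; apply: val_inj => /=; apply/eqP.
by rewrite eqn_leq ni -ltnS prednK ?ltn_ord.
Qed.

End DirectSystem.

Lemma field_mod_integersP (K L : fieldType) (v : discreteValuation K)
    (iota : {rmorphism K -> L}) :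
  field_mod_ring (val : ring_of_integers v iota -> L)
    (lquot_pi (@integers_in_field K L v iota) :
       L -> field_mod_integers v iota).
Proof.
split=> [x y|a x|y|x]; first exact: lquot_piD.
- exact: (lquot_piZ (@integers_in_field K L v iota) a (x : field_module v iota)).
- exists (repr (y : {ideal_quot submod_group (@integers_in_field K L v iota)}%qT)).
  exact: lquot_piK.
split=> [/lquot_pi_eq0 xO|[a <-]].
  by exists (Integers (xO : x \in integers_pred v (full_subext iota))).
by apply/lquot_pi_eq0; apply: (valP a).
Qed.

Lemma down_closed_card n (S : {set 'I_n}) :
  (forall i i' : 'I_n, (i <= i')%N -> i' \in S -> i \in S) ->
  forall i : 'I_n, (i \in S) = (i < #|S|)%N.
Proof.
move=> S_down i; have card_lt (k : nat) :
    (k <= n)%N -> #|[set c : 'I_n | (c < k)%N]| = k.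
  move=> kn; rewrite -sum1_card (eq_bigl (fun c : 'I_n => (c < k)%N)).
    by rewrite (big_ord_narrow kn) sum1_card card_ord.
  by move=> c; rewrite inE.
have [iS|iS] := boolP (i \in S); apply/esym.
  rewrite -(card_lt i.+1) //; apply: subset_leq_card; apply/subsetP => c.
  by rewrite inE ltnS => /S_down; apply.
apply/negbTE; rewrite -leqNgt -(card_lt i (ltnW (ltn_ord i))).
apply: subset_leq_card; apply/subsetP => c cS; rewrite inE ltnNge.
by apply: contra iS => /S_down; apply.
Qed.

(** * The structure of good modules *)

Lemma lmod_isom_full_submod (A : comNzRingType) (V U : lmodType A)
    (N : submodClosed V) :
  (forall x, x \in N) -> lmod_isom (submod N) U -> lmod_isom V U.
Proof.
move=> N_full [f [f' f'K fK]].
apply: (lmod_isom_of_relation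
  (R := fun x y => exists2 t : submod N, val t = x & f t = y)).
- by move=> x; exists (f (Submod (N_full x))), (Submod (N_full x)).
- by move=> y; exists (val (f' y)), (f' y).
- move=> a _ _ _ _ [t <- <-] [t' <- <-]; exists (a *: t + t') => //.
  by rewrite linearP.
- by move=> y [t t0 <-]; rewrite (_ : t = 0) ?raddf0 //; apply: val_inj.
move=> x [t <- ft0]; rewrite (_ : t = 0) //.
by apply: (can_inj f'K); rewrite ft0 raddf0.
Qed.

Theorem theorem3p8 (p : nat) (K L : fieldType) (v : discreteValuation K)
    (iota : {rmorphism K -> L}) (M : lmodType (ring_of_integers v iota))
    (n r : nat) :
  prime p ->
  local_field p v ->
  (forall x : L, algebraicOver iota x) ->
  good M ->
  good_invariants M p n r ->
  let LmodOL (s : nat) := {ffun 'I_s -> field_mod_integers v iota} in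
  let Mdiv_eq_pM (m : nat) :=
    max_pdivisible p (multiples M (p ^ m)) /\
    lmod_isom (submod (multiples M (p ^ m))) (LmodOL r) in
  ((exists m0 : nat, forall m : nat, (m0 <= m)%N -> Mdiv_eq_pM m) /\
   (r = n -> Mdiv_eq_pM 0%N)) /\
  ((exists s : nat, lmod_isom M (LmodOL s)) <-> r = n).
Proof.
move=> p_pr locK L_alg _ [D [e [Dn [w wvp He] Er]]] LmodOL Mdiv_eq_pM.
have wp := w_p locK wvp.
have p0 : p%:R != 0 :> L.
  by rewrite -(rmorph_nat iota) fmorph_eq0 (natr_neq0 locK).
have AP := integers_valuation_ring locK wvp L_alg.
have e_anti l (i i' : 'I_n) : (i <= i')%N -> e l i' <= e l i.
  by have [H _ _] := He l; apply: H.
have e_ge0 l i : 0 <= e l i by have [_ H _] := He l.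
have x_ex l := cid (let: And3 _ _ H := He l in H).
pose x l := sval (x_ex l); have Hx l := svalP (x_ex l).
have x0 l i : x l i != 0 by have [/(_ i)[]] := Hx l.
have wx l i : w (val (x l i)) = e l i by have [/(_ i)[]] := Hx l.
have b_ex l := cid (cyclic_decomposition_basis (Hx l).2).
pose b l := sval (b_ex l); have Hb l := svalP (b_ex l).
have bx l : diagonal_relations (b l) (x l) := (Hb l).1.
have b_gen l u : in_span (b l) u := (Hb l).2 u.
have gx := ds_exhaustion e_anti bx b_gen x0 wx.
(* the exponents decrease in [i], so the unbounded ones are those of index < r *)
set S := [set i | _] in Er.
have S_down (i i' : 'I_n) : (i <= i')%N -> i' \in S -> i \in S.
  move=> ii'; rewrite !inE => /asboolP H; apply/asboolP => c.
  by have [l cl] := H c; exists l; apply: lt_le_trans cl _; apply: e_anti.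
have inS := down_closed_card S_down; rewrite -Er in inS.
have le_rn : (r <= n)%N by rewrite Er -[X in (_ <= X)%N]card_ord max_card.
have unbounded (i : 'I_n) : (i < r)%N -> forall c, exists l, c < w (val (x l i)).
  by rewrite -inS inE => /asboolP H c; have [l cl] := H c; exists l; rewrite wx.
have cofree m : (forall (i : 'I_n) l, (r <= i)%N -> w (val (x l i)) <= m%:R) ->
    Mdiv_eq_pM m.
  move=> bounded; split.
    have H := multiples_max_pdivisible AP p0 wp gx le_rn; exact: (H unbounded m).
  have H := multiples_cofree AP p0 wp gx le_rn.
  exact: (H unbounded m bounded _ _ (field_mod_integersP v iota)).
have cofree0 : r = n -> Mdiv_eq_pM 0%N.
  by move=> rn; apply: cofree => i l; rewrite rn leqNgt ltn_ord.
split; first split=> //.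
  have [m0 Hm0] : exists k, forall (i : 'I_n) m, (k <= m)%N -> (r <= i)%N ->
      forall l, w (val (x l i)) <= m%:R.
    apply: uniform_bound => i; have [ir|ri] := ltnP i r; first by exists 0%N.
    have : i \notin S by rewrite inS -leqNgt.
    rewrite inE => /asboolPn/existsNP [c /forallNP Hc].
    exists (Num.bound `|c|) => m cm _ l; rewrite wx.
    have : e l i <= c by rewrite leNgt; apply/negP/Hc.
    move=> /le_trans; apply; apply: le_trans (ler_norm _) _.
    apply: le_trans (ltW (archi_boundP (normr_ge0 _))) _.
    by rewrite ler_nat.
  by exists m0 => m m0m; apply: cofree => i l ri; apply: Hm0.
split=> [[s [f f_bij]]|rn]; last first.
  exists r; have [_] := cofree0 rn; apply: lmod_isom_full_submod => y.
  by apply/asboolP; exists y; rewrite expn0 mulr1n.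
have Mdiv (y : M) : exists y', y = y' *+ p.
  have [f' f'K fK] := f_bij.
  have [piD _ pi_surj _] := field_mod_integersP v iota.
  have [z Ez] := choice (fun i => pi_surj (f y i)).
  pose pi : L -> _ := lquot_pi (@integers_in_field K L v iota).
  exists (f' [ffun i => pi (z i / p%:R)]).
  apply: (can_inj f'K); rewrite raddfMn /= fK; apply/ffunP => i.
  rewrite ffunMnE ffunE -Ez -[LHS]/(pi (z i)).
  rewrite -{1}[z i](divfK p0) mulr_natr.
  exact: (raddfMn
    (\pi_({ideal_quot submod_group (@integers_in_field K L v iota)}))%qT).
apply/eqP; rewrite eqn_leq le_rn /= leqNgt; apply/negP => lt_rn.
have n_gt0 : (0 < n)%N by apply: leq_ltn_trans lt_rn.
have [l0 l0_gt0] :=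
  positive_exponents locK L_alg wvp e_anti bx b_gen x0 wx e_ge0 Dn n_gt0.
have : Ordinal lt_rn \notin S by rewrite inS ltnn.
rewrite inE => /asboolPn/existsNP [c /forallNP Hc].
have [|l] := divisible_unbounded AP p0 wp gx (Ordinal lt_rn) (l0 := l0) Mdiv _
  (Num.bound `|c|).
  by move=> i; rewrite /= wx.
rewrite /= wx => Hl; apply: (Hc l); apply: le_lt_trans Hl.
by apply: le_trans (ler_norm _) _; apply/ltW/archi_boundP.
Qed.
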